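(* Let $0 = s_0 < s_1 < \cdots < s_k < s_{k+1} = T$, put $\mathbf{s} = (s_1,\dots,s_k)$, and let $\mathbf{x}:[0,T]\to\mathbb{R}^n$ be an absolutely continuous solution of the initial value problem $$\dot{\mathbf{x}}(t) = \mathbf{F}(\mathbf{x}(t),t),\qquad \mathbf{F}(\mathbf{x},t) = \mathbf{f}_j(\mathbf{x},t)\ \text{ for } t\in(s_j,s_{j+1}),\ 0\le j\le k,\qquad \mathbf{x}(0)=\mathbf{x}_0 .$$ Suppose that the State Regularity property (defined in the context) holds at $\mathbf{x}$, and that $C:\mathbb{R}^n\to\mathbb{R}$ is Lipschitz continuously differentiable in a neighborhood of $\mathbf{x}(T)$. Then for $j=1,2,\dots,k$, the objective $C(\mathbf{s})$ is differentiable with respect to $s_j$ and $$\frac{\partial C}{\partial s_j}(\mathbf{s}) = H_{j-1}(\mathbf{x}(s_j),\mathbf{p}(s_j),s_j) - H_j(\mathbf{x}(s_j),\mathbf{p}(s_j),s_j),$$ where $H_j(\mathbf{x},\mathbf{p},t) = \mathbf{p}\,\mathbf{f}_j(\mathbf{x},t)$ and the row vector $\mathbf{p}:[0,T]\to\mathbb{R}^n$ is the solution of the linear differential equation $$\dot{\mathbf{p}}(t) = -\mathbf{p}(t)\nabla_x\mathbf{F}(\mathbf{x}(t),t),\quad t\in[0,T],\qquad \mathbf{p}(T)=\nabla C(\mathbf{x}(T)).$$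
   Context: Setting. $T>0$ and $\mathbf{x}_0\in\mathbb{R}^n$ are fixed. The underlying control problem is to minimize $C(\mathbf{x}(T))$ subject to $\dot{\mathbf{x}}=\mathbf{f}(\mathbf{x},\mathbf{u})$, $\mathbf{x}(0)=\mathbf{x}_0$, with $\mathbf{f}:\mathbb{R}^n\times\mathbb{R}^m\to\mathbb{R}^n$ and $C:\mathbb{R}^n\to\mathbb{R}$ differentiable; the control is given in feedback form $\mathbf{u}(t)=\boldsymbol{\phi}_j(\mathbf{x}(t),t)$ on $(s_j,s_{j+1})$, and $\mathbf{f}_j(\mathbf{x},t)=\mathbf{f}(\mathbf{x},\boldsymbol{\phi}_j(\mathbf{x},t))$, viewed as a map $\mathbb{R}^n\times[0,T]\to\mathbb{R}^n$, $0\le j\le k$. The functions $\boldsymbol{\phi}_j$ (hence $\mathbf{f}_j$) do not depend on $\mathbf{s}$. Objective as a function of switching points. For switching points $\mathbf{s}$ with $0=s_0<s_1<\cdots<s_k<s_{k+1}=T$, $C(\mathbf{s})$ denotes $C(\mathbf{x}(T))$, where $\mathbf{x}$ is the solution of the initial value problem associated with $\mathbf{s}$. Differential equations are understood to hold at almost every $t$, with absolutely continuous solutions. Notation. $\|\cdot\|$ is any norm on $\mathbb{R}^n$, $\mathcal{B}_\rho(\mathbf{c})=\{\mathbf{x}\in\mathbb{R}^n:\|\mathbf{x}-\mathbf{c}\|\le\rho\}$. $\nabla C$ is a row vector; $\nabla_x\mathbf{F}$ is the Jacobian of $\mathbf{F}$ with respect to $\mathbf{x}$ ($(i,l)$ entry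 $\partial F_i/\partial x_l$). State Regularity. There exist constants $\rho>0$, $s_j^-\in(s_{j-1},s_j)$ and $s_j^+\in(s_j,s_{j+1})$, $1\le j\le k$, such that, with $s_0^-=0$ and $s_{k+1}^+=T$, for each $0\le j\le k$ the function $\mathbf{f}_j$ is continuously differentiable on the tube $$\mathcal{T}_j=\{(\boldsymbol{\chi},t): t\in[s_j^-,s_{j+1}^+]\text{ and }\boldsymbol{\chi}\in\mathcal{B}_\rho(\mathbf{x}(t))\}.$$ Moreover, $\mathbf{f}_j(\boldsymbol{\chi},t)$ is Lipschitz continuously differentiable with respect to $\boldsymbol{\chi}$ on $\mathcal{T}_j$ (i.e. $\nabla_\chi\mathbf{f}_j(\cdot,t)$ is Lipschitz), uniformly in $j$ and $t\in[s_j^-,s_{j+1}^+]$. *)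

(* Defs.v *)
From mathcomp Require Export all_boot all_order all_algebra.
From mathcomp Require Export all_classical all_reals all_analysis.
Import Order.TTheory GRing.Theory Num.Theory.
Import numFieldNormedType.Exports.

Set Implicit Arguments.
Unset Strict Implicit.
Unset Printing Implicit Defensive.

Local Open Scope classical_set_scope.
Local Open Scope ring_scope.

(* Vectors of R^n are rows 'rV_n, as the library's Jacobian requires; so the
   product p f of a row and a column vector reads p *m f^T below. *)

Definition is_norm (R : realType) (n : nat) (N : 'rV[R]_n -> R) : Prop :=
  [/\ forall u v, N (u + v) <= N u + N v,
      forall (a : R) u, N (a *: u) = `|a| * N u
    & forall u, N u = 0 -> u = 0].

Definition abs_continuous (R : realType) (V : normedModType R) (a b : R)
    (g : R -> V) : Prop :=
  forall e : R, 0 < e -> exists2 d : R, 0 < d &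
    forall (m : nat) (u v : 'I_m -> R),
      (forall i, a <= u i /\ u i < v i /\ v i <= b) ->
      (forall i j, i != j -> v i <= u j \/ v j <= u i) ->
      \sum_(i < m) (v i - u i) < d ->
      \sum_(i < m) `|g (v i) - g (u i)| < e.

Definition unique_on (R : realType) (V : normedModType R) (a b : R)
    (P : (R -> V) -> Prop) : Prop :=
  exists2 g, P g & forall h, P h -> forall t, a <= t <= b -> h t = g t.

Definition row_grad (R : realType) (n : nat) (C : 'rV[R]_n -> R)
    (z : 'rV[R]_n) : 'rV[R]_n :=
  \row_i 'D_(delta_mx 0 i) C z.

(* 'J g z has (l, i) entry d g_i / d z_l; the usual Jacobian, with (i, l) entry
   d g_i / d z_l, is its transpose. *)
Definition jac (R : realType) (n m : nat) (g : 'rV[R]_n -> 'rV[R]_m)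
    (z : 'rV[R]_n) : 'M[R]_(m, n) :=
  ('J g z)^T.

Definition lipschitz_C1_near (R : realType) (n : nat) (C : 'rV[R]_n -> R)
    (z0 : 'rV[R]_n) : Prop :=
  exists2 U : set 'rV[R]_n, nbhs z0 U &
    (forall z, U z -> differentiable C z) /\
    [lipschitz row_grad C z | z in U].

Definition closed_loop (R : realType) (n m k : nat)
    (f : 'rV[R]_n * 'rV[R]_m -> 'rV[R]_n)
    (phi : 'I_k.+1 -> 'rV[R]_n -> R -> 'rV[R]_m) :
    'I_k.+1 -> 'rV[R]_n -> R -> 'rV[R]_n :=
  fun j x t => f (x, phi j x t).

(* For v = (v_1, ..., v_k), stored with indices 0, ..., k - 1, the extended
   family with v_0 = 0 and v_{k+1} = T. *)
Definition knot (R : realType) (k : nat) (T : R) (v : 'rV[R]_k) (i : nat) : R :=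
  if i is i'.+1 then oapp (v 0) T (insub i') else 0.

Definition switching_points (R : realType) (k : nat) (T : R)
    (s : 'rV[R]_k) : Prop :=
  forall i : nat, (i <= k)%N -> knot T s i < knot T s i.+1.

(* F(x, t) = f_j(x, t) for s_j < t < s_{j+1}. The value 0 taken at the finitely
   many other times is irrelevant, equations being imposed almost everywhere. *)
Definition switched (R : realType) (n k : nat) (T : R)
    (fs : 'I_k.+1 -> 'rV[R]_n -> R -> 'rV[R]_n) (s : 'rV[R]_k)
    (x : 'rV[R]_n) (t : R) : 'rV[R]_n :=
  if [pick j : 'I_k.+1 | knot T s j < t < knot T s j.+1] is Some j
  then fs j x t else 0.

Definition state_solution (R : realType) (n k : nat) (T : R) (x0 : 'rV[R]_n)
    (fs : 'I_k.+1 -> 'rV[R]_n -> R -> 'rV[R]_n) (s : 'rV[R]_k)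
    (x : R -> 'rV[R]_n) : Prop :=
  [/\ abs_continuous 0 T x,
      {ae lebesgue_measure, forall t : R, 0 < t < T ->
         is_derive t (1 : R) x (switched T fs s (x t) t)}
    & x 0 = x0].

(* The solution is selected by choice, so the value is meaningful where the
   initial value problem associated with s has exactly one solution. *)
Definition objective (R : realType) (n k : nat) (T : R) (x0 : 'rV[R]_n)
    (fs : 'I_k.+1 -> 'rV[R]_n -> R -> 'rV[R]_n) (C : 'rV[R]_n -> R)
    (s : 'rV[R]_k) : R :=
  C (get (state_solution T x0 fs s) T).

Definition costate_solution (R : realType) (n k : nat) (T : R)
    (fs : 'I_k.+1 -> 'rV[R]_n -> R -> 'rV[R]_n) (C : 'rV[R]_n -> R)
    (s : 'rV[R]_k) (x p : R -> 'rV[R]_n) : Prop :=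
  [/\ abs_continuous 0 T p,
      {ae lebesgue_measure, forall t : R, 0 < t < T ->
         is_derive t (1 : R) p
           (- (p t *m jac (fun z => switched T fs s z t) (x t)))}
    & p T = row_grad C (x T)].

Definition hamiltonian (R : realType) (n k : nat)
    (fs : 'I_k.+1 -> 'rV[R]_n -> R -> 'rV[R]_n) (j : 'I_k.+1)
    (x p : 'rV[R]_n) (t : R) : R :=
  (p *m (fs j x t)^T) 0 0.

Definition tube (R : realType) (n : nat) (N : 'rV[R]_n -> R)
    (x : R -> 'rV[R]_n) (rho a b : R) : set ('rV[R]_n * R) :=
  [set z | a <= z.2 <= b /\ N (z.1 - x z.2) <= rho].

(* Differentiability relative to A, since tubes are closed and f_j need not be
   meaningful for t outside [0, T]. *)
Definition is_diff_within (R : realType) (V W : normedModType R) (A : set V)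
    (g : V -> W) (a : V) (dg : V -> W) : Prop :=
  forall e : R, 0 < e ->
    \forall z \near within A (nbhs a),
      `|g z - g a - dg (z - a)| <= e * `|z - a|.

(* g is C^1 on A; Dx and Dt are its derivatives in the first and second
   variable. *)
Definition C1_on (R : realType) (n : nat) (A : set ('rV[R]_n * R))
    (g : 'rV[R]_n * R -> 'rV[R]_n)
    (Dx : 'rV[R]_n * R -> 'M[R]_n) (Dt : 'rV[R]_n * R -> 'rV[R]_n) : Prop :=
  [/\ forall a, A a ->
        is_diff_within A g a (fun h => h.1 *m (Dx a)^T + h.2 *: Dt a),
      {within A, continuous Dx}
    & {within A, continuous Dt}].

(* sm and sp hold the s_j^- and s_j^+ for 1 <= j <= k, and knot supplies
   s_0^- = 0 and s_{k+1}^+ = T. *)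
Definition state_regularity (R : realType) (n k : nat) (N : 'rV[R]_n -> R)
    (T : R) (fs : 'I_k.+1 -> 'rV[R]_n -> R -> 'rV[R]_n) (s : 'rV[R]_k)
    (x : R -> 'rV[R]_n) : Prop :=
  exists (rho : R) (sm sp : 'rV[R]_k) (L : R),
    [/\ 0 < rho,
        forall i : nat, (1 <= i <= k)%N ->
          knot T s i.-1 < knot T sm i < knot T s i /\
          knot T s i < knot T sp i < knot T s i.+1
      & forall j : 'I_k.+1,
          let A := tube N x rho (knot T sm j) (knot T sp j.+1) in
          exists (Dx : 'rV[R]_n * R -> 'M[R]_n) (Dt : 'rV[R]_n * R -> 'rV[R]_n),
            C1_on A (fun z => fs j z.1 z.2) Dx Dt /\
            forall t : R, L.-lipschitz_([set c | A (c, t)]) (fun c => Dx (c, t))].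

(* Main.v *)
Require Import Defs.
From mathcomp Require Import lra ring zify.
Import Order.TTheory GRing.Theory Num.Theory.
Import numFieldNormedType.Exports.

Local Open Scope classical_set_scope.
Local Open Scope ring_scope.

Set Implicit Arguments.
Unset Strict Implicit.
Unset Printing Implicit Defensive.

(** Write y for the trajectory of the problem whose switching time s_j is moved
    by h, x for the original trajectory, f_i for the fields, and H_i = p f_i.

    No equation is integrated: every estimate comes from one mean value
    inequality, [ac_increment_le], for an absolutely continuous function whose
    derivative is bounded almost everywhere. Applied on short intervals it gives
    the Gronwall inequality [gronwall], hence uniqueness and the continuous
    dependence of solutions on the data.

    Away from the tubes nothing is known about the fields. They are therefore
    replaced by fields g_i that agree with f_i on thinner tubes and are bounded,
    Lipschitz in the state and continuous on the whole space
    ([state_regularity_extension]). For the g_i, Picard iteration solves every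
    perturbed problem on all of [0, T] ([solvable_switched]), and the solution y
    satisfies |y - x| = O(|h|) ([perturbed_close]). For small h it runs inside
    the tubes, so it solves the perturbed problem with the f_i as well. No other
    solution exists: a solution that coincides with y up to some time is still
    in the tube shortly afterwards, where Gronwall applies
    ([perturbed_unique]).

    The derivative is read off the scalar function q = p (y - x). It vanishes up
    to the first of the times s_j and s_j + h. Between these times x and y obey
    different fields, q' is close to H_{j-1} - H_j at s_j, up to the sign of h,
    and so q grows by h (H_{j-1} - H_j) + o(h) ([inside_rate]). Afterwards both
    obey the same field, and the costate equation cancels the part of q' that is
    linear in y - x, leaving q' = O(|y - x|^2) = O(h^2) ([outside_rate]).
    Altogether q(T) = h (H_{j-1} - H_j) + o(h) ([pairing_expansion]), while
    C(y(T)) - C(x(T)) = q(T) + o(h) because p(T) is the gradient of C at x(T). *)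

(** * Interval induction *)

(** Cousin's lemma: the supremum of the c for which P a c holds is b, since P
    holds on a neighbourhood of it and can be chained. *)
Lemma interval_induction (R : realType) (P : R -> R -> Prop) (a b : R) :
  a <= b ->
  (forall u w v, a <= u -> u <= w -> w <= v -> v <= b ->
     P u w -> P w v -> P u v) ->
  (forall t, a <= t <= b -> exists2 d, 0 < d &
     forall u v, a <= u -> u <= t -> t <= v -> v <= b -> v - u < d -> P u v) ->
  P a b.
Proof.
move=> ab Padd Ploc.
pose S := [set c | a <= c <= b /\ P a c].
have Sa : S a.
  split; first by rewrite lexx.
  have [|d d0 Pd] := Ploc a; first by rewrite lexx.
  by apply: Pd; rewrite ?lexx // subrr.
have ubS : ubound S b by move=> c [/andP[]].
have hsS : has_sup S by split; [exists a | exists b].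
have cab : a <= sup S <= b.
  by rewrite ub_le_sup ?ge_sup //; [exists a | exists b].
have [d d0 Pd] := Ploc _ cab; set c := sup S in cab Pd.
have /andP[ac cb] := cab.
have [c' [/andP[ac' c'b] Pac'] cc'] : exists2 c', S c' & c - d / 2 < c'.
  by apply: sup_adherent => //; lra.
have c'c : c' <= c by apply: ub_le_sup; [exists b | split=> //; rewrite ac'].
(* From c' to c + d / 3 there is less than d, so P extends beyond c unless b is
   reached. *)
have [bcd|cdb] := leP b (c + d / 3).
  by apply: (Padd a c' b) => //; apply: Pd; lra.
have : S (c + d / 3).
  split; first by lra.
  by apply: (Padd a c' (c + d / 3)) => //; [lra|lra|apply: Pd; lra].
move=> /(ub_le_sup (ex_intro _ b ubS)).
rewrite -/c; lra.
Qed.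

Lemma is_deriveP (R : realType) (U V : normedModType R) (g : U -> V) (a u : U) v :
  is_derive a u g v <->
  forall e, 0 < e -> exists2 d, 0 < d & forall h : R, `|h| < d ->
    `|g (a + h *: u) - g a - h *: v| <= e * `|h|.
Proof.
split.
- move=> [/derivable_nbhs dg <-] e e0.
  move/eqaddoP : dg => /(_ e e0) /=.
  move=> /nbhs_normP[d /= d0 H]; exists d => // h hd.
  have := H h; rewrite /ball_ /= sub0r normrN => /(_ hd).
  by rewrite !fctE opprD addrA /cst /= [h *: u + a]addrC.
- move=> H.
  have cv : (fun h : R => h^-1 *: ((g \o shift a) (h *: u) - g a)) @ 0^' --> v.
    apply/cvgrPdist_le => e e0.
    have [d d0 Hd] := H e e0.
    near=> h.
    have hn0 : h != 0 by near: h; exact: nbhs_dnbhs_neq.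
    have hd : `|h| < d by near: h; exact: dnbhs0_lt.
    have := Hd h hd; rewrite /= [h *: u + a]addrC => E.
    rewrite -[X in X - _](scalerK hn0) -scalerBr normrZ normfV.
    by rewrite ler_pdivrMl ?normr_gt0 // mulrC -normrN opprB.
  by split; [apply/cvg_ex; exists v | apply/cvg_lim].
Unshelve. all: by end_near. Qed.

Lemma is_derive1P (R : realType) (V : normedModType R) (g : R -> V) (t : R) v :
  is_derive t (1 : R) g v <->
  forall e, 0 < e -> exists2 d, 0 < d & forall h, `|h| < d ->
    `|g (t + h) - g t - h *: v| <= e * `|h|.
Proof.
split=> [/is_deriveP H e /H[d d0 Hd] | H].
  by exists d => // h /Hd; rewrite [h *: 1]mulr1.
apply/is_deriveP => e /H[d d0 Hd].
by exists d => // h /Hd; rewrite [h *: 1]mulr1.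
Qed.

(** * Mean value inequality for absolutely continuous functions *)

Lemma ae_imply2 (R : realType) (P Q S : R -> Prop) :
  {ae lebesgue_measure, forall t : R, P t} ->
  {ae lebesgue_measure, forall t : R, Q t} ->
  (forall t, P t -> Q t -> S t) ->
  {ae lebesgue_measure, forall t : R, S t}.
Proof.
move=> p q H; have aeF := @ae_filter_ringOfSetsType _ _ _ (@lebesgue_measure R).
exact: filterS2 p q.
Qed.

Lemma ae_imply (R : realType) (P S : R -> Prop) :
  {ae lebesgue_measure, forall t : R, P t} ->
  (forall t, P t -> S t) ->
  {ae lebesgue_measure, forall t : R, S t}.
Proof. by move=> p H; apply: (ae_imply2 p p) => t /H. Qed.

Lemma ae_neq (R : realType) (c : R) :
  {ae lebesgue_measure, forall t : R, t <> c}.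
Proof.
exists [set c]; split=> //; first exact: lebesgue_measure_set1.
by move=> t /= /contrapT.
Qed.

(** Outer regularity of Lebesgue measure, in the form in which absolute
    continuity can use it. *)
Lemma ae_open_cover (R : realType) (Q : R -> Prop) (d : R) :
  {ae lebesgue_measure, forall t : R, Q t} -> 0 < d ->
  exists G : set R, [/\ open G, forall t, ~ Q t -> G t
    & (lebesgue_measure G < d%:E)%E].
Proof.
move=> [Z [mZ Z0 QZ]] d0.
have [|G [oG ZG Gd]] := @lebesgue_regularity_outer R Z d mZ _ d0.
  by rewrite [X in (X < _)%E]Z0.
exists G; split=> //; first by move=> t nQ; apply/ZG/QZ.
have -> : G = Z `|` (G `\` Z) by rewrite setDUK.
have mG : measurable G by exact: measurable_realfun.open_measurable.
rewrite measureU // ?[X in (X + _ < _)%E]Z0 ?add0e //.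
- exact: measurableD.
- by rewrite setDIK.
Qed.

Section ACMeanValue.
Variables (R : realType) (V : normedModType R).
Local Notation mu := (@lebesgue_measure R).

Lemma abs_continuous_seq (a b : R) (g : R -> V) (e d : R) :
  (forall (m : nat) (u v : 'I_m -> R),
      (forall i, a <= u i /\ u i < v i /\ v i <= b) ->
      (forall i j, i != j -> v i <= u j \/ v j <= u i) ->
      \sum_(i < m) (v i - u i) < d ->
      \sum_(i < m) `|g (v i) - g (u i)| < e) ->
  forall s : seq (R * R),
    all (fun p => [&& a <= p.1, p.1 < p.2 & p.2 <= b]) s ->
    pairwise (fun p q => p.2 <= q.1) s ->
    \sum_(p <- s) (p.2 - p.1) < d ->
    \sum_(p <- s) `|g p.2 - g p.1| < e.
Proof.
move=> H s /allP sab /(pairwiseP (0, 0)) sdis.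
rewrite !(big_nth (0, 0)) !big_mkord => sd.
apply: (H _ (fun i => (nth (0, 0) s i).1) (fun i => (nth (0, 0) s i).2)) => //.
  by move=> i; have /and3P[] := sab _ (mem_nth (0, 0) (ltn_ord i)).
move=> i j ij; have [lij|lji|eij] := ltngtP i j.
- by left; apply: sdis => //; exact: ltn_ord.
- by right; apply: sdis => //; exact: ltn_ord.
- by move: ij; rewrite (val_inj eij) eqxx.
Qed.

(** Cover the exceptional null set by an open set G of small measure. Near a time
    where the derivative exists and is at most M in norm, increments are at most
    (M + e) times the length; every other time has a neighbourhood in G. Interval
    induction then splits [a, b] into intervals of the first kind, and intervals
    of the second kind, disjoint and inside G, whose increments add up to at most
    e by absolute continuity. *)
Lemma ac_increment_le (a b : R) (g : R -> V) (M : R) :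
  a <= b -> 0 <= M -> abs_continuous a b g ->
  {ae mu, forall t : R, a < t < b ->
     exists2 d, is_derive t (1 : R) g d & `|d| <= M} ->
  `|g b - g a| <= M * (b - a).
Proof.
move=> ab M0 acg aeg.
suff key e : 0 < e -> `|g b - g a| <= (M + e) * (b - a) + e.
  apply/ler_addgt0Pr => e e0.
  have e'0 : 0 < e / (b - a + 1) by rewrite divr_gt0 //; lra.
  apply: (le_trans (key _ e'0)).
  rewrite mulrDl -addrA lerD2l -[X in _ + X]mulr1 -mulrDr.
  by rewrite divfK //; lra.
move=> e0.
have [d d0 Hd] := acg e e0.
have aeg' : {ae mu, forall t : R, a <= t <= b ->
     exists2 d, is_derive t (1 : R) g d & `|d| <= M}.
  have aeab := ae_imply2 (ae_neq a) (ae_neq b) (fun t => @conj _ _).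
  apply: (ae_imply2 aeg aeab) => t H [ta tb] /andP[at_ tb'].
  by apply: H; rewrite !lt_neqAle at_ tb' !andbT eq_sym; apply/andP; split; apply/eqP.
have [G [oG QG muG]] := ae_open_cover aeg' d0.
have mG : measurable G by exact: measurable_realfun.open_measurable.
(* The half-open interval makes the measure bound exactly additive. *)
pose P u v := exists s : seq (R * R), [/\
  all (fun p => [&& u <= p.1, p.1 < p.2 & p.2 <= v]) s,
  pairwise (fun p q => p.2 <= q.1) s,
  ((\sum_(p <- s) (p.2 - p.1))%:E <= mu (G `&` `]u, v]))%E
  & `|g v - g u| <= (M + e) * (v - u) + \sum_(p <- s) `|g p.2 - g p.1| ].
suff [s [s1 s2 s3 s4]] : P a b.
  have := abs_continuous_seq Hd s1 s2.
  have sd : \sum_(p <- s) (p.2 - p.1) < d.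
    rewrite -lte_fin; apply: (le_lt_trans s3); apply: le_lt_trans muG.
    by apply: le_measure => //; rewrite ?inE //; exact: measurableI.
  by move=> /(_ sd) s5; lra.
apply: interval_induction => //.
- move=> u w v au uw wv vb [s [s1 s2 s3 s4]] [r [r1 r2 r3 r4]].
  exists (s ++ r); split.
  + rewrite all_cat; apply/andP; split.
      by apply: sub_all s1 => p /and3P[-> -> /=]; lra.
    by apply: sub_all r1 => p /and3P[? -> -> /=]; lra.
  + rewrite pairwise_cat s2 r2 !andbT; apply/allrelP => p q.
    by move=> /(allP s1)/and3P[_ _ +] /(allP r1)/and3P[+ _ _] => /le_trans; exact.
  + have -> : G `&` `]u, v] = (G `&` `]u, w]) `|` (G `&` `]w, v]).
      by rewrite -setIUr -itv_bndbnd_setU // bnd_simp.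
    rewrite measureU; [|exact: measurableI|exact: measurableI|].
      by rewrite big_cat /= EFinD leeD.
    rewrite -subset0 => t [[_ /=]]; rewrite in_itv /= => /andP[_ tw] [_ /=].
    by rewrite in_itv /= => /andP[wt _]; lra.
  + rewrite big_cat /=.
    have -> : g v - g u = (g v - g w) + (g w - g u) by rewrite addrA subrK.
    by apply: (le_trans (ler_normD _ _)); lra.
- move=> t tab.
  have [[d' dg d'M]|nQ] := pselect (exists2 d, is_derive t (1 : R) g d & `|d| <= M).
    have /is_derive1P /(_ e e0)[r r0 Hr] := dg.
    exists r => // u v au ut tv vb uvr; exists [::]; split=> //.
      by rewrite big_nil.
    rewrite big_nil addr0.
    have Hvu h : `|h| < r -> `|g (t + h) - g t| <= (M + e) * `|h|.
      move=> /Hr H; rewrite -[_ - _](subrK (h *: d')).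
      apply: (le_trans (ler_normD _ _)); rewrite mulrDl addrC lerD // normrZ.
      by rewrite mulrC ler_wpM2r.
    have -> : g v - g u = (g (t + (v - t)) - g t) - (g (t + (u - t)) - g t).
      by rewrite ![t + _]addrC !subrK opprB addrA subrK.
    apply: (le_trans (ler_normB _ _)).
    have := Hvu (v - t); rewrite ger0_norm ?subr_ge0 // => Hv.
    have := Hvu (u - t); rewrite ler0_norm ?subr_le0 // => Hu.
    apply: (le_trans (lerD (Hv _) (Hu _))); [lra|lra|].
    by rewrite -mulrDr ler_wpM2l //; lra.
  have Gt : G t by apply: QG => /(_ tab).
  have /nbhs_normP := open_nbhs_nbhs (conj oG Gt).
  move=> [r /= r0 rG]; exists r => // u v au ut tv vb uvr.
  have [<-|uv] := eqVneq u v.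
    exists [::]; split => //; rewrite big_nil //.
    by rewrite !subrr normr0 mulr0 addr0.
  have {}uv : u < v by rewrite lt_neqAle uv; lra.
  exists [:: (u, v)]; split => //=.
  + by rewrite uv !lexx.
  + rewrite big_seq1 /= [X in mu X](_ : _ = `]u, v]%classic).
      by rewrite lebesgue_measure_itv /= lte_fin uv EFinD.
    apply/setIidr => y /=; rewrite in_itv /= => /andP[uy yv]; apply: rG.
    by rewrite /ball_ /= ltr_norml; lra.
  + rewrite big_seq1 /= lerDr mulr_ge0 //; lra.
Qed.

End ACMeanValue.

(** * Absolutely continuous functions and the Gronwall inequality *)

Section ACTheory.
Variables (R : realType) (V : normedModType R).
Local Notation mu := (@lebesgue_measure R).
Implicit Types (g w : R -> V) (a b : R).

Definition lipschitz_on_itv (a b : R) (K : R) (g : R -> V) :=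
  forall u v, a <= u <= b -> a <= v <= b -> `|g v - g u| <= K * `|v - u|.

Lemma ac_sub a b a' b' g : a <= a' -> b' <= b ->
  abs_continuous a b g -> abs_continuous a' b' g.
Proof.
move=> aa bb H e /H[d d0 {}H]; exists d => // m u v Huv; apply: H => i.
by have [? [? ?]] := Huv i; lra.
Qed.

Lemma ac_uniform a b g : abs_continuous a b g -> forall e, 0 < e ->
  exists2 d, 0 < d & forall u v, a <= u <= b -> a <= v <= b ->
    `|v - u| < d -> `|g v - g u| < e.
Proof.
move=> H e e0; have [d d0 {}H] := H e e0; exists d => //.
have key u v : a <= u -> u < v -> v <= b -> v - u < d -> `|g v - g u| < e.
  move=> au uv vb uvd.
  have := H 1 (fun _ => u) (fun _ => v); rewrite !big_ord1; apply=> //.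
  by move=> i j; rewrite !ord1 eqxx.
move=> u v uab vab; have [uv|vu|->] := ltgtP u v.
- by rewrite gtr0_norm ?subr_gt0 // => ?; apply: key => //; lra.
- rewrite distrC gtr0_norm ?subr_gt0 // => ?; rewrite distrC.
  by apply: key => //; lra.
- by rewrite !subrr !normr0.
Qed.

Lemma lipschitz_ac a b K g : lipschitz_on_itv a b K g -> abs_continuous a b g.
Proof.
move=> H e e0; have K0 : 0 < `|K| + 1 by rewrite ltr_wpDl.
exists (e / (`|K| + 1)); first by rewrite divr_gt0.
move=> m u v Huv _ sd.
apply: (@le_lt_trans _ _ ((`|K| + 1) * \sum_(i < m) (v i - u i))).
  rewrite mulr_sumr; apply: ler_sum => i _.
  have [? [? ?]] := Huv i.
  apply: (le_trans (H _ _ _ _)); [lra|lra|].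
  rewrite ger0_norm ?subr_ge0; last lra.
  by rewrite ler_wpM2r ?subr_ge0; [| lra | have := ler_norm K; lra].
by rewrite mulrC -ltr_pdivlMr.
Qed.

Lemma acB a b g w : abs_continuous a b g -> abs_continuous a b w ->
  abs_continuous a b (fun t => g t - w t).
Proof.
move=> Hg Hw e e0; have e20 : 0 < e / 2 by lra.
have [d d0 {}Hg] := Hg _ e20; have [c c0 {}Hw] := Hw _ e20.
exists (Num.min d c); first by rewrite lt_min d0.
move=> m u v Huv dis; rewrite lt_min => /andP[sd sc].
apply: (@le_lt_trans _ _ (\sum_(i < m) (`|g (v i) - g (u i)| + `|w (v i) - w (u i)|))).
  apply: ler_sum => i _; apply: le_trans (ler_normB (g (v i) - g (u i)) (w (v i) - w (u i))).
  by rewrite opprD addrACA -opprD.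
by rewrite big_split /=; have := Hg _ _ _ Huv dis sd; have := Hw _ _ _ Huv dis sc; lra.
Qed.

Lemma locally_bounded_itv a b g : a <= b ->
  (forall t, a <= t <= b -> exists2 d, 0 < d & forall s, a <= s <= b ->
     `|s - t| < d -> `|g s - g t| <= 1) ->
  exists2 B, 0 <= B & forall t, a <= t <= b -> `|g t| <= B.
Proof.
move=> ab H.
pose P u v := exists2 B, 0 <= B & forall t, u <= t <= v -> `|g t| <= B.
apply: (@interval_induction R P) => //.
- move=> u w v au uw wv vb [B B0 HB] [B' B'0 HB']; exists (B + B').
    by rewrite addr_ge0.
  move=> t /andP[ut tv]; have [tw|wt] := leP t w.
    by have := HB t; rewrite ut tw => /(_ isT); lra.
  by have := HB' t; rewrite tv (ltW wt) => /(_ isT); lra.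
- move=> t tab; have [d d0 Hd] := H t tab.
  exists d => // u v au ut tv vb uvd; exists (`|g t| + 1).
    by rewrite addr_ge0.
  move=> s sab; rewrite -[g s](subrK (g t)) addrC; apply: (le_trans (ler_normD _ _)).
  rewrite lerD2l Hd //; first lra.
  by rewrite ltr_norml; lra.
Qed.

Lemma ac_bounded a b g : a <= b -> abs_continuous a b g ->
  exists2 B, 0 <= B & forall t, a <= t <= b -> `|g t| <= B.
Proof.
move=> ab /ac_uniform/(_ 1 ltr01)[d d0 H]; apply: locally_bounded_itv => // t tab.
by exists d => // s sab std; rewrite ltW // H.
Qed.

Lemma ac_lipschitz a b g M : 0 <= M -> abs_continuous a b g ->
  {ae mu, forall t : R, a < t < b ->
     exists2 d, is_derive t (1 : R) g d & `|d| <= M} ->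
  lipschitz_on_itv a b M g.
Proof.
move=> M0 acg aeg.
have key u v : a <= u -> u <= v -> v <= b -> `|g v - g u| <= M * (v - u).
  move=> au uv vb; apply: ac_increment_le => //; first exact: ac_sub acg.
  apply: (ae_imply aeg) => t H tuv; apply: H.
  lra.
move=> u v uab vab; have [uv|vu] := leP u v.
- by rewrite ger0_norm ?subr_ge0 //; apply: key => //; lra.
- by rewrite distrC ltr0_norm ?subr_lt0 // opprB; apply: key => //; lra.
Qed.

(** The constant serves all subintervals and all w at once, which is what makes
    the estimates below uniform in h; this is why the induction is on a statement
    quantified over w. On an interval of length at most 1 / (2 (L + 1)), the
    mean value inequality gives sup |w| <= |w s| + sup |w| / 2 for every s in it, so that
    the constant 2 suffices in both directions of time. *)
Lemma gronwall a b L : a <= b -> 0 <= L ->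
  exists2 G, 1 <= G & forall a' b' w, a <= a' -> a' <= b' -> b' <= b ->
   abs_continuous a' b' w ->
   {ae mu, forall t : R, a' < t < b' ->
     exists2 d, is_derive t (1 : R) w d & `|d| <= L * `|w t|} ->
   forall t s, a' <= t <= b' -> a' <= s <= b' -> `|w t| <= G * `|w s|.
Proof.
move=> ab L0.
pose P a b := exists2 G, 1 <= G & forall a' b' w,
   a <= a' -> a' <= b' -> b' <= b -> abs_continuous a' b' w ->
   {ae mu, forall t : R, a' < t < b' ->
     exists2 d, is_derive t (1 : R) w d & `|d| <= L * `|w t|} ->
   forall t s, a' <= t <= b' -> a' <= s <= b' -> `|w t| <= G * `|w s|.
apply: (@interval_induction R P) => //.
- move=> u c v au uc cv vb [G G1 HG] [G' G'1 HG']; exists (G * G').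
    by rewrite -[1]mulr1 ler_pM.
  have G0 : 0 <= G by lra.
  have G'0 : 0 <= G' by lra.
  move=> a' b' w ua' ab' b'v acw aew.
  have [b'c|/ltW cb'] := leP b' c.
    move=> t s tab sab.
    apply: (le_trans (HG a' b' w ua' ab' b'c acw aew t s tab sab)).
    by rewrite ler_wpM2r // ler_peMr.
  have [ca'|/ltW a'c] := leP c a'.
    move=> t s tab sab.
    apply: (le_trans (HG' a' b' w ca' ab' b'v acw aew t s tab sab)).
    by rewrite ler_wpM2r // ler_peMl.
  have H1 : forall t s, a' <= t <= c -> a' <= s <= c -> `|w t| <= G * `|w s|.
    apply: HG => //; first exact: ac_sub acw.
    by apply: (ae_imply aew) => t H ?; apply: H; lra.
  have H2 : forall t s, c <= t <= b' -> c <= s <= b' -> `|w t| <= G' * `|w s|.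
    apply: HG' => //; first exact: ac_sub acw.
    by apply: (ae_imply aew) => t H ?; apply: H; lra.
  have GG t : `|w t| <= G * `|w t| by rewrite ler_peMl.
  have GG' t : `|w t| <= G' * `|w t| by rewrite ler_peMl.
  move=> t s /andP[ut tv] /andP[us sv].
  have [tc|/ltW ct] := leP t c; have [sc|/ltW cs] := leP s c.
  + rewrite -mulrA (le_trans (H1 t s _ _)) ?ut ?tc ?us //.
    by rewrite ler_wpM2l.
  + rewrite -mulrA (le_trans (H1 t c _ _)) ?ut ?tc ?a'c ?lexx //.
    by rewrite ler_wpM2l // H2 ?lexx ?cb' ?cs.
  + rewrite mulrAC (le_trans (H2 t c _ _)) ?ct ?tv ?cb' ?lexx //.
    by rewrite mulrC ler_wpM2r // H1 ?a'c ?lexx ?us ?sc.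
  + rewrite mulrAC (le_trans (H2 t s _ _)) ?ct ?tv ?cs ?sv //.
    by rewrite mulrC ler_wpM2r.
- move=> t0 t0ab; have d0 : 0 < (2 * (L + 1))^-1 by rewrite invr_gt0; lra.
  exists (2 * (L + 1))^-1 => // u' v' au ut tv vb uvd.
  exists 2 => [|u v w uu uv vv acw aew t s tuv suv]; first lra.
  have [B B0 HB] := ac_bounded uv acw.
  pose A := [set `|w t| | t in [set t | u <= t <= v]].
  have supA : has_sup A.
    split; first by exists (`|w t|), t.
    by exists B => _ [r ruv <-]; exact: HB.
  have leS r : u <= r <= v -> `|w r| <= sup A.
    by move=> ruv; apply: ub_le_sup; [exact: supA.2 | exists r].
  have S0 : 0 <= sup A by apply: le_trans (leS t tuv).
  have Lw : lipschitz_on_itv u v (L * sup A) w.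
    apply: ac_lipschitz => //; first exact: mulr_ge0.
    apply: (ae_imply aew) => r H ruv.
    have [//|d Hd dL] := H _; exists d => //; apply: (le_trans dL).
    by rewrite ler_wpM2l // leS //; lra.
  have key r : u <= r <= v -> `|w r| <= `|w s| + sup A / 2.
    move=> ruv; rewrite -[w r](subrK (w s)) addrC.
    apply: (le_trans (ler_normD _ _)); rewrite lerD2l.
    apply: (le_trans (Lw s r suv ruv)).
    rewrite mulrAC mulrC ler_wpM2l //.
    have rs : `|r - s| <= (2 * (L + 1))^-1 by rewrite ler_norml; lra.
    apply: (@le_trans _ _ ((L + 1) * (2 * (L + 1))^-1)).
      by rewrite ler_pM //; lra.
    by rewrite invfM mulrCA mulfV ?mulr1 //; lra.
  suff : sup A <= `|w s| + sup A / 2 by have := leS t tuv; lra.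
  by apply: ge_sup; [exists (`|w t|), t | move=> _ [r ruv <-]; exact: key].
Qed.

End ACTheory.

(** * Row vectors: norm, derivatives, primitives *)

Section MatrixNorm.
Variable R : realType.

Lemma coord_norm_le (m n : nat) (A : 'M[R]_(m, n)) i j : `|A i j| <= `|A|.
Proof.
rewrite [leRHS]/Num.Def.normr /= mx_normrE.
exact: (le_bigmax _ (fun k => `|A k.1 k.2|) (i, j)).
Qed.

Lemma mx_norm_le (m n : nat) (A : 'M[R]_(m, n)) e :
  0 <= e -> (forall i j, `|A i j| <= e) -> `|A| <= e.
Proof.
move=> e0 H; rewrite [leLHS]/Num.Def.normr /= mx_normrE.
by apply: bigmax_le => // i _; exact: H.
Qed.

Lemma mulmx_norm_le (m n p : nat) (A : 'M[R]_(m, n)) (B : 'M[R]_(n, p)) :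
  `|A *m B| <= n%:R * (`|A| * `|B|).
Proof.
apply: mx_norm_le => [|i j]; first by rewrite !mulr_ge0.
rewrite mxE; apply: (le_trans (ler_norm_sum _ _ _)).
apply: (@le_trans _ _ (\sum_(k < n) `|A| * `|B|)).
  by apply: ler_sum => k _; rewrite normrM ler_pM ?coord_norm_le.
by rewrite sumr_const card_ord mulr_natl.
Qed.

Lemma trmx_norm (m n : nat) (A : 'M[R]_(m, n)) : `|A^T| = `|A|.
Proof.
apply/eqP; rewrite eq_le; apply/andP; split; apply: mx_norm_le => // i j.
  by rewrite mxE coord_norm_le.
by have := coord_norm_le A^T j i; rewrite mxE.
Qed.

Lemma is_derive_row (n : nat) (y : R -> 'rV[R]_n) (v : 'rV[R]_n) (t : R) :
  (forall i, is_derive t (1 : R) (fun s => y s 0 i) (v 0 i)) ->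
  is_derive t (1 : R) y v.
Proof.
move=> H; apply/is_derive1P => e e0.
have : \forall h \near (0 : R), forall i,
    `|y (t + h) 0 i - y t 0 i - h *: v 0 i| <= e * `|h|.
  near=> h => i; move: i; near: h; apply: filter_forall => i.
  have /is_derive1P/(_ _ e0)[d d0 Hd] := H i.
  by near=> h; apply: Hd; near: h; apply: (@nbhs0_lt R R).
move=> /nbhs_normP[d /= d0 Hd]; exists d => // h hd.
apply: mx_norm_le => [|i j]; first by rewrite mulr_ge0 // ltW.
rewrite ord1 !mxE; apply: Hd.
by rewrite /ball_ /= sub0r normrN.
Unshelve. all: by end_near. Qed.

Lemma is_derive_coord (n : nat) (y : R -> 'rV[R]_n) (v : 'rV[R]_n) (t : R) i :
  is_derive t (1 : R) y v -> is_derive t (1 : R) (fun s => y s 0 i) (v 0 i).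
Proof.
move=> /is_derive1P H; apply/is_derive1P => e /H[d d0 Hd]; exists d => // h hd.
apply: le_trans (Hd h hd).
have := coord_norm_le (y (t + h) - y t - h *: v) 0 i.
by rewrite !mxE.
Qed.

(** The bound D m = 2 B / 2^m is chosen so that D m = B / 2^m + D (m + 1), which
    makes the sum of the steps telescope. *)
Lemma geometric_cauchy_real (u : nat -> R) (B : R) :
  0 <= B -> (forall m, `|u m.+1 - u m| <= B / 2 ^+ m) ->
  exists l, forall m, `|l - u m| <= 2 * B / 2 ^+ m.
Proof.
move=> B0 Hu.
pose D m : R := 2 * B / 2 ^+ m.
have D0 m : 0 <= D m by rewrite divr_ge0 ?mulr_ge0 ?exprn_ge0.
have DS m : D m = B / 2 ^+ m + D m.+1.
  have -> : D m.+1 = B / 2 ^+ m by rewrite /D exprS -mulf_div divff // mul1r.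
  by rewrite /D -mulrDl -mulr2n mulr_natl.
have H m p : `|u (m + p)%N - u m| <= D m - D (m + p)%N.
  elim: p => [|p IH]; first by rewrite addn0 !subrr normr0.
  rewrite addnS; have := Hu (m + p)%N; have := DS (m + p)%N.
  have := ler_distD (u (m + p)%N) (u (m + p).+1) (u m); lra.
have D_small e : 0 < e -> exists m, D m < e.
  move=> e0.
  exists (Num.Def.archi_bound (2 * B / e)).
  have := @upper_nthrootP _ (2 * B / e) _ (leqnn _).
  by rewrite ltr_pdivrMr // [X in _ < X]mulrC -ltr_pdivrMr ?exprn_gt0.
have Hle m p : (m <= p)%N -> `|u p - u m| <= D m.
  by move=> /subnKC <-; have := H m (p - m)%N; have := D0 (m + (p - m))%N; lra.
have cu : cvgn u.
  apply/cauchy_cvgP; apply: cauchy_exP => e e0.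
  have [N HN] := D_small e e0; exists (u N); exists N => // p /= Np.
  by rewrite /ball /= distrC; apply: le_lt_trans HN; exact: Hle.
exists (lim (u @ \oo)) => m; rewrite -/(D m).
have : (fun p => `|u p - u m|) @ \oo --> `|lim (u @ \oo) - u m|.
  by apply: cvg_norm; apply: cvgB => //; exact: cvg_cst.
move=> cl; rewrite -(cvg_lim (@norm_hausdorff _ _) cl); apply: limr_le.
  by apply/cvg_ex; eexists; exact: cl.
by exists m => // p /= mp; exact: Hle.
Qed.

Lemma geometric_cauchy (n : nat) (u : nat -> 'rV[R]_n) (B : R) :
  0 <= B -> (forall m, `|u m.+1 - u m| <= B / 2 ^+ m) ->
  exists l, forall m, `|l - u m| <= 2 * B / 2 ^+ m.
Proof.
move=> B0 Hu.
have Hi i : exists l, forall m, `|l - u m 0 i| <= 2 * B / 2 ^+ m.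
  apply: geometric_cauchy_real => // m; apply: le_trans (Hu m).
  by have := coord_norm_le (u m.+1 - u m) 0 i; rewrite !mxE.
have [l Hl] := choice Hi; exists (\row_i l i) => m.
apply: mx_norm_le => [|i j]; first by rewrite divr_ge0 ?mulr_ge0 ?exprn_ge0.
by rewrite ord1 !mxE.
Qed.

(** The primitive is an integral from a, so it is differentiable only to the
    right of a. *)
Lemma primitive_real (c : R -> R) (a : R) : continuous c ->
  exists F : R -> R, forall t, a < t -> is_derive t (1 : R) F (c t).
Proof.
move=> cc; exists (fun x => \int[@lebesgue_measure R]_(t in `[a, x]) c t)%R => t at_.
have tt : t < t + 1 by rewrite ltrDl.
have ci : (@lebesgue_measure R).-integrable `[a, t + 1] (EFin \o c).
  apply: continuous_compact_integrable; first exact: segment_compact.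
  exact: continuous_subspaceT.
have [dF FE] := continuous_FTC1_closed tt ci at_ (cc t).
by split; [exact: dF | rewrite -derive1E; exact: FE].
Qed.

Lemma primitive_row (n : nat) (c : R -> 'rV[R]_n) (a : R) : continuous c ->
  exists F : R -> 'rV[R]_n, forall t, a < t -> is_derive t (1 : R) F (c t).
Proof.
move=> cc.
have Hi i : exists F : R -> R, forall t, a < t -> is_derive t (1 : R) F (c t 0 i).
  apply: primitive_real => t.
  by apply: (@continuous_comp _ _ _ c (fun M : 'rV[R]_n => M 0 i));
    [exact: cc | exact: coord_continuous].
have [F HF] := choice Hi; exists (fun t => \row_i F i t) => t at_.
apply: is_derive_row => i.
by under eq_fun do rewrite mxE; exact: HF.
Qed.

End MatrixNorm.

(** * Increments of functions of a real variable *)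

Section Increments.
Variables (R : realType) (V : normedModType R).

(** The hypothesis says that the upper derivative of g, taken within [a, b], is
    at most M; it also covers functions that are differentiable only relative to
    a closed interval. *)
Lemma increment_le (a b M : R) (g : R -> V) : a <= b ->
  (forall e t, 0 < e -> a <= t <= b -> exists2 d, 0 < d &
     forall s, a <= s <= b -> `|s - t| < d -> `|g s - g t| <= (M + e) * `|s - t|) ->
  `|g b - g a| <= M * (b - a).
Proof.
move=> ab H; apply/ler_addgt0Pr => e e0.
have e'0 : 0 < e / (b - a + 1) by rewrite divr_gt0 //; lra.
set e' := e / _ in e'0.
suff : `|g b - g a| <= (M + e') * (b - a).
  move=> /le_trans; apply; rewrite mulrDl lerD2l /e' mulrAC ler_pdivrMr; last lra.
  by rewrite ler_pM2l //; lra.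
pose P u v := `|g v - g u| <= (M + e') * (v - u).
apply: (@interval_induction R P) => //.
- move=> u w v au uw wv vb; rewrite /P => H1 H2.
  by have := ler_distD (g w) (g v) (g u); lra.
- move=> t tab; have [d d0 Hd] := H _ _ e'0 tab; exists d => // u v au ut tv vb uvd.
  have := Hd u; rewrite [`|u - t|]distrC [`|t - u|]ger0_norm ?subr_ge0 //.
  move=> Hu; have := Hd v; rewrite [`|v - t|]ger0_norm ?subr_ge0 // => Hv.
  have {}Hu := Hu ltac:(lra) ltac:(lra); have {}Hv := Hv ltac:(lra) ltac:(lra).
  by rewrite /P; have := ler_distD (g t) (g v) (g u); rewrite [`|g t - g u|]distrC; lra.
Qed.

Lemma derivative_lipschitz (a b M : R) (g dg : R -> V) :
  (forall t, a <= t <= b -> is_derive t (1 : R) g (dg t)) ->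
  (forall t, a <= t <= b -> `|dg t| <= M) -> lipschitz_on_itv a b M g.
Proof.
move=> Hd HM.
have key u v : a <= u -> u <= v -> v <= b -> `|g v - g u| <= M * (v - u).
  move=> au uv vb; apply: increment_le => // e t e0 tuv.
  have tab : a <= t <= b by lra.
  have /is_derive1P/(_ e e0)[d d0 H] := Hd t tab.
  exists d => // s suv std.
  have := H _ std; rewrite [t + _]addrC subrK => {}H.
  rewrite -[g s - g t](subrK ((s - t) *: dg t)); apply: (le_trans (ler_normD _ _)).
  rewrite mulrDl addrC lerD // normrZ mulrC ler_wpM2r //.
  exact: HM.
move=> u v uab vab; have [uv|vu] := leP u v.
- by rewrite ger0_norm ?subr_ge0 //; apply: key => //; lra.
- by rewrite distrC ltr0_norm ?subr_lt0 // opprB; apply: key => //; lra.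
Qed.

Lemma continuous_epsP (g : R -> V) (t : R) :
  {for t, continuous g} <-> forall e, 0 < e -> exists2 d, 0 < d &
    forall s, `|s - t| < d -> `|g s - g t| < e.
Proof.
split.
- move=> /cvgrPdist_lt H e e0; have /nbhs_normP[d /= d0 Hd] := H e e0.
  exists d => // s std; rewrite distrC; apply: Hd.
  by rewrite /ball_ /= distrC.
- move=> H; apply/cvgrPdist_lt => e e0; have [d d0 Hd] := H e e0.
  near=> s; rewrite distrC; apply: Hd; rewrite distrC; near: s.
  exact: (@cvgr_dist_lt _ _ _ _ _ id).
Unshelve. all: by end_near. Qed.

Lemma continuous_bounded (a b : R) (g : R -> V) : a <= b -> continuous g ->
  exists2 B, 0 <= B & forall t, a <= t <= b -> `|g t| <= B.
Proof.
move=> ab cg; apply: locally_bounded_itv => // t _.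
have /continuous_epsP/(_ 1 ltr01)[d d0 H] := cg t.
by exists d => // s _ std; rewrite ltW // H.
Qed.

Lemma is_derive_continuous (g : R -> V) (t : R) v :
  is_derive t (1 : R) g v -> {for t, continuous g}.
Proof.
by case=> dg _; apply: differentiable_continuous; apply/derivable1_diffP.
Qed.

End Increments.

Section Clamp.
Variable R : realType.

Definition clamp (a b t : R) : R := Num.max a (Num.min b t).

Lemma clamp_itv (a b t : R) : a <= b -> a <= clamp a b t <= b.
Proof. by move=> ab; rewrite /clamp le_max lexx ge_max ab ge_min lexx. Qed.

Lemma clamp_id (a b t : R) : a <= t <= b -> clamp a b t = t.
Proof. by move=> /andP[at_ tb]; rewrite /clamp (min_idPr tb) (max_idPr at_). Qed.

Lemma clamp_lipschitz (a b s t : R) : a <= b ->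
  `|clamp a b s - clamp a b t| <= `|s - t|.
Proof.
move=> ab; rewrite /clamp /Num.max /Num.min.
case: (ltP b s) => ?; case: (ltP b t) => ?; case: (ltP a b) => ?;
  case: (ltP a s) => ?; case: (ltP a t) => ?;
  rewrite ler_norml; case: (ger0P (s - t)) => ?; lra.
Qed.

Lemma clamp_continuous (a b : R) : a <= b -> continuous (clamp a b).
Proof.
move=> ab t; apply/(@continuous_epsP R R) => e e0; exists e => // s std.
by apply: le_lt_trans std; exact: clamp_lipschitz.
Qed.

End Clamp.

(** * Existence of solutions *)

Section Picard.
Variables (R : realType) (n : nat).
Local Notation V := 'rV[R]_n.
Local Notation mu := (@lebesgue_measure R).
Implicit Types (G : R -> V -> V) (y : R -> V).

(** Picard iteration on an interval short enough for the Picard operator to halve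
    uniform distances. The initial time t0 may be either end point, so that
    equations can be solved backwards too, and the iterates are extended to the
    whole line by clamping time, so that they are continuous functions on R. *)
Lemma picard_local G (a b L t0 : R) (c : V) :
  a <= b -> a <= t0 <= b -> 0 <= L -> L * (b - a) <= 2^-1 ->
  (forall y, continuous y -> continuous (fun t => G t (y t))) ->
  (forall t z z', `|G t z - G t z'| <= L * `|z - z'|) ->
  exists y, [/\ y t0 = c, exists K, lipschitz_on_itv a b K y &
    forall t, a < t < b -> is_derive t (1 : R) y (G t (y t))].
Proof.
move=> ab t0ab L0 Lab cG lG.
have prim y : exists F : R -> V, continuous y ->
    forall t, a <= t -> is_derive t (1 : R) F (G t (y t)).
  have [cy|] := pselect (continuous y); last by exists y.
  have [F HF] := primitive_row (a - 1) (cG _ cy).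
  by exists F => _ t at_; apply: HF; lra.
have [Phi HPhi] := choice prim.
pose cl := clamp a b.
have clab t : a <= cl t <= b by exact: clamp_itv.
pose Pic y t := c + (Phi y (cl t) - Phi y t0).
have cPic y : continuous y -> continuous (Pic y).
  move=> cy t; apply: cvgD; first exact: cvg_cst.
  apply: cvgB; last exact: cvg_cst.
  apply: continuous_comp; first exact: clamp_continuous.
  apply: is_derive_continuous; apply: HPhi => //.
  by have /andP[] := clab t.
have clt0 t : `|cl t - t0| <= b - a by have := clab t; rewrite ler_norml; lra.
have Pic_le y D : continuous y ->
    (forall t, a <= t <= b -> `|G t (y t)| <= D) ->
    forall t, `|Pic y t - c| <= D * (b - a).
  move=> cy HD t; rewrite /Pic [c + _]addrC addrK.
  have D0 : 0 <= D by apply: le_trans (HD _ t0ab).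
  have H := @derivative_lipschitz _ _ a b D (Phi y) (fun t => G t (y t)).
  apply: (le_trans (H _ HD t0 (cl t) t0ab (clab t))); last by rewrite ler_wpM2l.
  by move=> s /andP[as_ _]; exact: HPhi.
have Pic_contr y y' D : continuous y -> continuous y' ->
    (forall t, `|y t - y' t| <= D) -> forall t, `|Pic y t - Pic y' t| <= D / 2.
  move=> cy cy' HD t.
  have D0 : 0 <= D by apply: le_trans (HD t0).
  have -> : Pic y t - Pic y' t =
      (Phi y (cl t) - Phi y' (cl t)) - (Phi y t0 - Phi y' t0).
    by rewrite /Pic opprD addrACA subrr add0r opprD addrACA -opprD.
  have := @derivative_lipschitz _ _ a b (L * D) (fun t => Phi y t - Phi y' t)
    (fun t => G t (y t) - G t (y' t)).
  move=> H; apply: (le_trans (H _ _ t0 (cl t) t0ab (clab t))).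
  - by move=> s /andP[as_ _]; apply: is_deriveB; exact: HPhi.
  - by move=> s _; apply: (le_trans (lG _ _ _)); rewrite ler_wpM2l.
  - rewrite mulrAC mulrC ler_wpM2l //; apply: le_trans Lab.
    by rewrite ler_wpM2l.
pose u m := iter m Pic (fun _ => c).
have cu m : continuous (u m).
  by elim: m => [|m IH]; [move=> t; exact: cvg_cst | exact: cPic].
have [D D0 HD] := continuous_bounded ab (cG _ (cu 0%N)).
pose B := D * (b - a).
have B0 : 0 <= B by rewrite mulr_ge0 ?subr_ge0.
(* Consecutive iterates are at distance at most B / 2^m. *)
have ustep m t : `|u m.+1 t - u m t| <= B / 2 ^+ m.
  elim: m t => [|m IH] t; first by
    rewrite expr0 divr1; exact: (Pic_le (u 0%N) D (cu 0%N) HD t).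
  by rewrite exprSr invfM mulrA; exact: (Pic_contr (u m.+1) (u m) _ (cu m.+1) (cu m) IH).
have [y Hy] := choice (fun t => @geometric_cauchy _ _ (fun m => u m t) _ B0 (ustep ^~ t)).
have small e : 0 < e -> exists m, 2 * B / 2 ^+ m < e.
  move=> e0; exists (Num.Def.archi_bound (2 * B / e)).
  have := @upper_nthrootP _ (2 * B / e) _ (leqnn _).
  by rewrite ltr_pdivrMr // [X in _ < X]mulrC -ltr_pdivrMr ?exprn_gt0.
have cy : continuous y.
  move=> t; apply/continuous_epsP => e e0.
  have e30 : 0 < e / 3 by lra.
  have [m Hm] := small _ e30.
  have /continuous_epsP/(_ _ e30)[d d0 Hd] := cu m t.
  exists d => // s /Hd Hs.
  have := ler_distD (u m s) (y s) (y t); have := ler_distD (u m t) (u m s) (y t).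
  have := Hy s m; have := Hy t m; rewrite [`|y t - _|]distrC; lra.
have yE t : y t = Pic y t.
  apply/eqP; rewrite -subr_eq0 -normr_le0; apply/ler_addgt0Pr => e e0.
  have [m Hm] := small _ e0; rewrite add0r; apply: le_trans (ltW Hm).
  have := Pic_contr _ _ _ (cu m) cy (fun t => _) t.
  move=> /(_ (2 * B / 2 ^+ m)) H.
  have {}H : `|u m.+1 t - Pic y t| <= 2 * B / 2 ^+ m / 2.
    by apply: H => s; rewrite distrC.
  have := Hy t m.+1; rewrite exprSr invfM mulrA.
  have := ler_distD (u m.+1 t) (y t) (Pic y t); lra.
have HPy := HPhi _ cy.
have [M M0 HM] := continuous_bounded ab (cG _ cy).
have yP t : a <= t <= b -> y t = c + (Phi y t - Phi y t0).
  by move=> tab; rewrite yE /Pic /cl clamp_id.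
have yB s t : a <= s <= b -> a <= t <= b -> y s - y t = Phi y s - Phi y t.
  move=> sab tab; rewrite !yP // opprD addrACA subrr add0r.
  by rewrite opprB addrA subrK.
exists y; split.
- by rewrite yP // subrr addr0.
- exists M => s t sab tab; rewrite yB //.
  have := @derivative_lipschitz _ _ a b M (Phi y) (fun t => G t (y t)).
  by apply => // r /andP[ar _]; exact: HPhi.
- move=> t /andP[at_ tb]; apply/is_derive1P => e e0.
  have /is_derive1P/(_ e e0)[d d0 Hd] := HPhi _ cy t (ltW at_).
  exists (Num.min d (Num.min (t - a) (b - t))).
    by rewrite !lt_min d0 !subr_gt0 at_ tb.
  move=> h; rewrite !lt_min !ltr_norml => /and3P[hd ha hb].
  rewrite yB; [|lra|lra].
  by apply: Hd; rewrite ltr_norml.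
Qed.

End Picard.

Section Solvable.
Variables (R : realType) (n : nat).
Local Notation V := 'rV[R]_n.
Local Notation mu := (@lebesgue_measure R).
Implicit Types (G : R -> V -> V) (y : R -> V).

Definition lipschitz_solution G (u v : R) y :=
  (exists K, lipschitz_on_itv u v K y) /\
  {ae mu, forall t : R, u < t < v -> is_derive t (1 : R) y (G t (y t))}.

Definition solvable G (u v : R) := forall c : V,
  (exists2 y, lipschitz_solution G u v y & y u = c) /\
  (exists2 y, lipschitz_solution G u v y & y v = c).

Lemma is_derive_near (y y' : R -> V) (t d : R) v : 0 < d ->
  (forall s, `|s - t| < d -> y' s = y s) ->
  is_derive t (1 : R) y v -> is_derive t (1 : R) y' v.
Proof.
move=> d0 H /is_derive1P Hy; apply/is_derive1P => e /Hy[d' d'0 Hd'].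
exists (Num.min d d'); first by rewrite lt_min d0.
move=> h; rewrite lt_min => /andP[hd hd']; rewrite !H.
- exact: Hd'.
- by rewrite subrr normr0.
- by rewrite [t + h]addrC addrK.
Qed.

(** The gluing time is a single point, hence does not matter for an equation that
    holds almost everywhere. *)
Lemma lipschitz_solution_cat G (u w v : R) y y' : u <= w -> w <= v ->
  lipschitz_solution G u w y -> lipschitz_solution G w v y' -> y w = y' w ->
  exists y'', [/\ lipschitz_solution G u v y'',
    forall t, t <= w -> y'' t = y t & forall t, w <= t -> y'' t = y' t].
Proof.
move=> uw wv [[K HK] aey] [[K' HK'] aey'] yw.
pose z t := if t <= w then y t else y' t.
have zl t : t <= w -> z t = y t by rewrite /z => ->.
have zr t : w <= t -> z t = y' t.
  by move=> wt; rewrite /z; case: (leP t w) => // tw; have -> : t = w by lra.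
exists z; split=> //; split.
- exists (`|K| + `|K'|).
  have Kle r : 0 <= r -> K * r <= (`|K| + `|K'|) * r.
    move=> r0; rewrite ler_wpM2r //; have := ler_norm K; have := normr_ge0 K'; lra.
  have K'le r : 0 <= r -> K' * r <= (`|K| + `|K'|) * r.
    move=> r0; rewrite ler_wpM2r //; have := ler_norm K'; have := normr_ge0 K; lra.
  have key s t : u <= s -> s <= t -> t <= v ->
      `|z t - z s| <= (`|K| + `|K'|) * (t - s).
    move=> us st tv; have [tw|/ltW wt] := leP t w.
      rewrite !zl; [|lra|lra]; apply: (le_trans (HK _ _ _ _)); [lra|lra|].
      by rewrite ger0_norm ?subr_ge0 // Kle // subr_ge0.
    have [sw|/ltW ws] := leP s w; last first.
      rewrite !zr; [|lra|lra]; apply: (le_trans (HK' _ _ _ _)); [lra|lra|].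
      by rewrite ger0_norm ?subr_ge0 // K'le // subr_ge0.
    apply: (le_trans (ler_distD (z w) _ _)).
    rewrite [X in _ <= X](_ : _ = (`|K| + `|K'|) * (t - w) + (`|K| + `|K'|) * (w - s)); last lra.
    rewrite lerD //.
      rewrite !zr //; apply: (le_trans (HK' _ _ _ _)); [lra|lra|].
      by rewrite ger0_norm ?subr_ge0 // K'le // subr_ge0.
    rewrite !zl //; apply: (le_trans (HK _ _ _ _)); [lra|lra|].
    by rewrite ger0_norm ?subr_ge0 // Kle // subr_ge0.
  move=> s t suv tuv; have [st|ts] := leP s t.
    by rewrite [`|t - s|]ger0_norm ?subr_ge0 //; apply: key => //; lra.
  rewrite [`|z t - z s|]distrC [`|t - s|]ltr0_norm ?subr_lt0 // opprB.
  by apply: (key t s); lra.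
- have aew := ae_imply2 aey aey' (fun t => @conj _ _).
  apply: (ae_imply2 aew (ae_neq w)) => t [H H'] tw tuv.
  have [{}tw|wt|//] := ltgtP t w.
    rewrite zl ?(ltW tw) //.
    apply: (@is_derive_near y _ _ (w - t)); rewrite ?subr_gt0 //.
      by move=> s; rewrite ltr_norml => ?; apply: zl; lra.
    by apply: H; lra.
  rewrite zr ?(ltW wt) //.
  apply: (@is_derive_near y' _ _ (t - w)); rewrite ?subr_gt0 //.
    by move=> s; rewrite ltr_norml => ?; apply: zr; lra.
  by apply: H'; lra.
Qed.

Lemma solvable_cat G (u w v : R) : u <= w -> w <= v ->
  solvable G u w -> solvable G w v -> solvable G u v.
Proof.
move=> uw wv H H' c; split.
- have [[y sy yc] _] := H c; have [[y' sy' yc'] _] := H' (y w).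
  have [z [sz zl _]] := lipschitz_solution_cat uw wv sy sy' (esym yc').
  by exists z => //; rewrite zl.
- have [_ [y' sy' yc']] := H' c; have [_ [y sy yc]] := H (y' w).
  have [z [sz _ zr]] := lipschitz_solution_cat uw wv sy sy' yc.
  by exists z => //; rewrite zr.
Qed.

Lemma solvable_eq G G' (u v : R) :
  (forall t z, u < t < v -> G t z = G' t z) -> solvable G u v -> solvable G' u v.
Proof.
move=> GG' H c; have [[y [Ly sy] yc] [y' [Ly' sy'] yc']] := H c.
split; [exists y | exists y'] => //; split => //.
  by apply: (ae_imply sy) => t Ht tuv; rewrite -GG' //; exact: Ht.
by apply: (ae_imply sy') => t Ht tuv; rewrite -GG' //; exact: Ht.
Qed.

(** Solvability from both ends is additive in the interval and holds on all
    intervals shorter than 1 / (2 (L + 1)). *)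
Lemma solvable_lipschitz G (a b L : R) : a <= b -> 0 <= L ->
  (forall y, continuous y -> continuous (fun t => G t (y t))) ->
  (forall t z z', `|G t z - G t z'| <= L * `|z - z'|) ->
  solvable G a b.
Proof.
move=> ab L0 cG lG; apply: (@interval_induction R (solvable G)) => //.
  by move=> u w v _ uw wv _; exact: solvable_cat.
move=> t tab; exists (2 * (L + 1))^-1; first by rewrite invr_gt0; lra.
move=> u v au ut tv vb uvd c.
have uv := le_trans ut tv.
have Luv : L * (v - u) <= 2^-1.
  apply: (@le_trans _ _ ((L + 1) * (2 * (L + 1))^-1)).
    by rewrite ler_pM //; lra.
  by rewrite invfM mulrCA mulfV ?mulr1 //; lra.
have aeT (P : R -> Prop) : (forall t, P t) -> {ae mu, forall t : R, P t}.
  by move=> HP; apply: (ae_imply (ae_neq 0)) => r _.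
split.
- have uu : u <= u <= v by rewrite lexx.
  have [y [yc Ly dy]] := picard_local c uv uu L0 Luv cG lG.
  by exists y => //; split=> //; exact: aeT.
- have vv : u <= v <= v by rewrite lexx uv.
  have [y [yc Ly dy]] := picard_local c uv vv L0 Luv cG lG.
  by exists y => //; split=> //; exact: aeT.
Qed.

End Solvable.

(** * Equations with switching times *)

Section Knots.
Variables (R : realType) (k : nat) (T : R) (s : 'rV[R]_k).
Hypothesis sT : switching_points T s.

Lemma knot_last : knot T s k.+1 = T.
Proof. by rewrite /= insubF // ltnn. Qed.

Lemma knotS (j : 'I_k) : knot T s j.+1 = s 0 j.
Proof. by rewrite /= valK. Qed.

Lemma knot_le i j : (i <= j <= k.+1)%N -> knot T s i <= knot T s j.
Proof.
elim: j => [|j IH]; first by case: i => //; rewrite lexx.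
case/andP; rewrite leq_eqVlt => /orP[/eqP -> //|ij jk].
by rewrite (le_trans (IH _)) ?ltW ?sT //; lia.
Qed.

Lemma knot_itv i : (i <= k.+1)%N -> 0 <= knot T s i <= T.
Proof.
move=> ik; apply/andP; split.
  by apply: (@knot_le 0 i); rewrite leq0n.
by rewrite -[leRHS]knot_last; apply: knot_le; rewrite ik /=.
Qed.

Lemma piece_unique (i j : 'I_k.+1) t :
  knot T s i < t < knot T s i.+1 -> knot T s j < t < knot T s j.+1 -> i = j.
Proof.
move=> ti tj; apply: val_inj; apply/eqP; rewrite eqn_leq.
apply/andP; split; rewrite leqNgt; apply/negP => lt.
  have : knot T s j.+1 <= knot T s i by apply: knot_le; rewrite lt ltnW // ltn_ord.
  by lra.
have : knot T s i.+1 <= knot T s j by apply: knot_le; rewrite lt ltnW // ltn_ord.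
by lra.
Qed.

Lemma switchedE (n : nat) (fs : 'I_k.+1 -> 'rV[R]_n -> R -> 'rV[R]_n)
    (j : 'I_k.+1) z t :
  knot T s j < t < knot T s j.+1 -> switched T fs s z t = fs j z t.
Proof.
move=> tj; rewrite /switched; case: pickP => [i ti|/(_ j)]; last by rewrite tj.
by rewrite (piece_unique ti tj).
Qed.

(** The switching times are finitely many, hence negligible. *)
Lemma ae_switched (P : R -> Prop) :
  (forall (j : 'I_k.+1) t, knot T s j < t < knot T s j.+1 -> P t) ->
  {ae lebesgue_measure, forall t : R, 0 < t < T -> P t}.
Proof.
move=> H.
have aek i : {ae lebesgue_measure, forall t : R,
    forall i', (i' <= i)%N -> t <> knot T s i'}.
  elim: i => [|i IH].
    by apply: (ae_imply (ae_neq (knot T s 0))) => t ? [].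
  apply: (ae_imply2 IH (ae_neq (knot T s i.+1))) => t H1 H2 i'.
  by rewrite leq_eqVlt => /orP[/eqP -> //|]; exact: H1.
apply: (ae_imply (aek k.+1)) => t ht /andP[t0 tT].
have key i : (i <= k.+1)%N -> knot T s i <= t \/ P t.
  elim: i => [|i IH] ik; first by left; rewrite /= ltW.
  have [it|] := IH (ltnW ik); last by right.
  have [|ti] := leP (knot T s i.+1) t; first by left.
  right; apply: (H (Ordinal ik)) => /=; rewrite ti andbT lt_neqAle it andbT.
  by apply/eqP => e; apply: (ht i (ltnW ik)).
by have [|//] := key k.+1 (leqnn _); rewrite knot_last; lra.
Qed.

(** Solutions are glued piece by piece: on each piece the switched field is one
    of the globally Lipschitz fields. *)
Lemma solvable_switched (n : nat) (L : R) (gs : 'I_k.+1 -> 'rV[R]_n -> R -> 'rV[R]_n) :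
  0 <= L ->
  (forall j (y : R -> 'rV[R]_n), continuous y -> continuous (fun t => gs j (y t) t)) ->
  (forall j t z z', `|gs j z t - gs j z' t| <= L * `|z - z'|) ->
  solvable (fun t z => switched T gs s z t) 0 T.
Proof.
move=> L0 cg lg.
have key i : (i <= k.+1)%N -> solvable (fun t z => switched T gs s z t) 0 (knot T s i).
  elim: i => [|i IH] ik.
    move=> c; split; exists (fun _ => c) => //; split.
    - by exists 0 => ? ? _ _; rewrite subrr normr0 mul0r.
    - by apply: (ae_imply (ae_neq 0)) => t _ /= ?; lra.
    - by exists 0 => ? ? _ _; rewrite subrr normr0 mul0r.
    - by apply: (ae_imply (ae_neq 0)) => t _ /= ?; lra.
  apply: (@solvable_cat _ _ _ _ (knot T s i)); [|exact/ltW/sT|exact: IH (ltnW ik)|].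
    by apply: (@knot_le 0 i); rewrite leq0n ltnW.
  apply: (@solvable_eq _ _ (fun t z => gs (Ordinal ik) z t)).
    by move=> t z tj; rewrite (@switchedE _ _ (Ordinal ik)).
  apply: (@solvable_lipschitz _ _ _ _ _ L) => //; first exact/ltW/sT.
  by move=> y cy; exact: cg.
by have := key k.+1 (leqnn _); rewrite knot_last.
Qed.

End Knots.

(** * Extension of the fields beyond the tubes *)

(** Tubes are given in terms of an arbitrary norm N, while estimates are made in
    the sup norm; this half of the equivalence of norms puts a sup-norm tube inside
    the given one. *)
Lemma norm_le_sup (R : realType) (n : nat) (N : 'rV[R]_n -> R) : is_norm N ->
  exists2 K, 0 < K & forall z, N z <= K * `|z|.
Proof.
move=> [Ntri Nscal _].
have N0 : N 0 = 0 by rewrite -(scale0r (0 : 'rV[R]_n)) Nscal normr0 mul0r.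
have Nge0 u : 0 <= N u.
  have := Ntri u (- u); rewrite subrr N0 -scaleN1r Nscal normrN1 mul1r; lra.
pose S := \sum_(i < n) N (delta_mx 0 i).
exists (S + 1); first by rewrite ltr_wpDl // sumr_ge0.
move=> z; apply: (@le_trans _ _ (S * `|z|)); last first.
  by rewrite ler_wpM2r // lerDl.
rewrite {1}(row_sum_delta z) /S mulr_suml.
elim/big_ind2: _ => [|a a' b b' H H'|i _].
- by rewrite N0.
- by apply: (le_trans (Ntri _ _)); rewrite lerD.
- by rewrite Nscal mulrC ler_wpM2l // coord_norm_le.
Qed.

Section EpsDelta.
Variables (R : realType) (V W : normedModType R).

Lemma is_diff_withinP (A : set V) (g : V -> W) (a : V) (dg : V -> W) :
  is_diff_within A g a dg -> forall e, 0 < e -> exists2 d, 0 < d &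
    forall z, A z -> `|z - a| < d -> `|g z - g a - dg (z - a)| <= e * `|z - a|.
Proof.
move=> H e /H /nbhs_normP[d /= d0 Hd]; exists d => // z Az zad.
by apply: Hd => //; rewrite /ball_ /= distrC.
Qed.

Lemma within_continuousP (A : set V) (g : V -> W) (a : V) :
  {within A, continuous g} -> A a -> forall e, 0 < e -> exists2 d, 0 < d &
    forall z, A z -> `|z - a| < d -> `|g z - g a| < e.
Proof.
move=> /subspace_continuousP H /H /cvgrPdist_lt Ha e /Ha.
move=> /nbhs_normP[d /= d0 Hd]; exists d => // z Az zad.
by rewrite distrC; apply: Hd => //; rewrite /ball_ /= distrC.
Qed.

End EpsDelta.

Section Retraction.
Variables (R : realType) (n : nat).
Local Notation V := 'rV[R]_n.

(** In the sup norm, clamping each coordinate is a 1-Lipschitz retraction onto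
    the ball of radius r; radial projection would not be 1-Lipschitz. *)
Definition retract (r : R) (z : V) : V := \row_i clamp (- r) r (z 0 i).

Lemma retract_norm r z : 0 <= r -> `|retract r z| <= r.
Proof.
move=> r0; apply: mx_norm_le => // i j; rewrite mxE ler_norml.
by apply: clamp_itv; lra.
Qed.

Lemma retract_id r z : `|z| <= r -> retract r z = z.
Proof.
move=> zr; apply/rowP => i; rewrite mxE clamp_id // -ler_norml.
by apply: le_trans zr; exact: coord_norm_le.
Qed.

Lemma retract_lipschitz r z z' : 0 <= r ->
  `|retract r z - retract r z'| <= `|z - z'|.
Proof.
move=> r0; apply: mx_norm_le => // i j; rewrite ord1 !mxE.
apply: (le_trans (clamp_lipschitz _ _ _)); first lra.
by have := coord_norm_le (z - z') 0 j; rewrite !mxE.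
Qed.

End Retraction.

Section ExtendsNear.
Variables (R : realType) (n : nat).
Local Notation V := 'rV[R]_n.

(** On the tube of radius r around x, at the times in I, the global field g
    coincides with F, and B is the Jacobian of F along x. One constant M serves as
    all the bounds. Continuity in time is required along continuous curves, the
    form in which it is used to form primitives. *)
Record extends_near (F : V -> R -> V) (x : R -> V) (I : R -> Prop) (r M : R)
    (g : V -> R -> V) (B : R -> 'M[R]_n) : Prop := ExtendsNear {
  ext_continuous : forall y, continuous y -> continuous (fun t => g (y t) t);
  ext_jac_continuous : continuous B;
  ext_lipschitz : forall t z z', `|g z t - g z' t| <= M * `|z - z'|;
  ext_bounded : forall z t, `|g z t| <= M;
  ext_jac_bounded : forall t, `|B t| <= M;
  ext_eq : forall z t, I t -> `|z - x t| <= r -> g z t = F z t;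
  ext_taylor : forall z t, I t -> `|z - x t| <= r ->
    `|g z t - g (x t) t - (z - x t) *m (B t)^T| <= M * `|z - x t| ^+ 2;
  ext_jac : forall t, I t -> jac (fun z => F z t) (x t) = B t }.

Lemma extends_near_weaken F x (I I' : R -> Prop) r M M' g B :
  (forall t, I' t -> I t) -> M <= M' ->
  extends_near F x I r M g B -> extends_near F x I' r M' g B.
Proof.
move=> II' MM' [h1 h2 h3 h4 h5 h6 h7 h8]; split=> //.
- by move=> t z z'; apply: (le_trans (h3 _ _ _)); rewrite ler_wpM2r.
- by move=> z t; apply: le_trans MM'.
- by move=> t; apply: le_trans MM'.
- by move=> z t /II'; exact: h6.
- by move=> z t /II' It zr; apply: (le_trans (h7 _ _ It zr)); rewrite ler_wpM2r.
- by move=> t /II'; exact: h8.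
Qed.

End ExtendsNear.

Section Tube.
Variables (R : realType) (n : nat).
Local Notation V := 'rV[R]_n.
Variables (A : set (V * R)) (F : V -> R -> V) (x : R -> V) (a b r : R).
Variables (Dx : V * R -> 'M[R]_n) (Dt : V * R -> V) (L : R).
Hypotheses (ab : a <= b) (r0 : 0 < r).
Hypothesis acx : abs_continuous a b x.
Hypothesis tubeA : forall z t, a <= t <= b -> `|z - x t| <= r -> A (z, t).
Hypothesis C1F : C1_on A (fun z => F z.1 z.2) Dx Dt.
Hypothesis LDx : forall z z' t, A (z, t) -> A (z', t) ->
  `|Dx (z, t) - Dx (z', t)| <= L * `|z - z'|.

Let xc (t : R) : V := x (clamp a b t).

(** The state is retracted onto the tube and time is clamped to [a, b], so that
    F and its derivative are only evaluated on A. *)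
Definition tube_point (z : V) (t : R) : V := xc t + retract r (z - xc t).

Definition tube_field (z : V) (t : R) : V := F (tube_point z t) (clamp a b t).

Definition tube_jac (t : R) : 'M[R]_n := Dx (xc t, clamp a b t).

Lemma pair_norm_lt (z z' : V) (t t' d : R) :
  (`|(z, t) - (z', t')| < d) = (`|z - z'| < d) && (`|t - t'| < d).
Proof. by rewrite prod_normE /= gt_max. Qed.

Lemma xc_continuous : continuous xc.
Proof.
move=> t; apply/continuous_epsP => e e0.
have [d d0 Hd] := ac_uniform acx e0.
exists d => // s std; apply: Hd; [exact: clamp_itv|exact: clamp_itv|].
by apply: le_lt_trans std; exact: clamp_lipschitz.
Qed.

Lemma tube_pointP z t : A (tube_point z t, clamp a b t).
Proof.
apply: tubeA; first exact: clamp_itv.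
by rewrite /tube_point [xc t + _]addrC addrK retract_norm // ltW.
Qed.

Lemma tube_center t : A (xc t, clamp a b t).
Proof. by apply: tubeA; [exact: clamp_itv | rewrite subrr normr0 ltW]. Qed.

Lemma tube_point_id z t : a <= t <= b -> `|z - x t| <= r -> tube_point z t = z.
Proof.
move=> tab zr; rewrite /tube_point /xc clamp_id // retract_id //.
by rewrite addrC subrK.
Qed.

Lemma tube_point_continuous (y : R -> V) : continuous y ->
  continuous (fun t => tube_point (y t) t).
Proof.
move=> cy t; apply/continuous_epsP => e e0.
have e30 : 0 < e / 3 by lra.
have /continuous_epsP/(_ _ e30)[d d0 Hd] := @xc_continuous t.
have /continuous_epsP/(_ _ e30)[d' d'0 Hd'] := cy t.
exists (Num.min d d'); first by rewrite lt_min d0.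
move=> s; rewrite lt_min => /andP[/Hd Hs /Hd' Hs'].
rewrite /tube_point opprD addrACA.
apply: (le_lt_trans (ler_normD _ _)).
have := retract_lipschitz (y s - xc s) (y t - xc t) (ltW r0).
rewrite opprD addrACA -opprD.
have := ler_normB (y s - y t) (xc s - xc t); lra.
Qed.

(** Differentiability relative to A gives joint continuity on A. *)
Lemma C1_continuous p e : A p -> 0 < e -> exists2 d, 0 < d &
  forall q, A q -> `|q - p| < d -> `|F q.1 q.2 - F p.1 p.2| < e.
Proof.
case: C1F => dF _ _ Ap e0.
have [d d0 Hd] := is_diff_withinP (dF _ Ap) ltr01.
pose K := 2 + n%:R * `|Dx p| + `|Dt p|.
have K0 : 0 < K by have : 0 <= n%:R * `|Dx p| by []; have := normr_ge0 (Dt p); rewrite /K; lra.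
exists (Num.min d (e / K)); first by rewrite lt_min d0 divr_gt0.
move=> q Aq; rewrite lt_min => /andP[qd]; rewrite ltr_pdivlMr // => qe.
apply: le_lt_trans qe; have := Hd q Aq qd; rewrite mul1r => {}Hd.
set h := q - p in Hd *.
rewrite -[X in `|X|](subrK (h.1 *m (Dx p)^T + h.2 *: Dt p)).
apply: (le_trans (ler_normD _ _)).
apply: (le_trans (lerD Hd (ler_normD _ _))).
have h1 : `|h.1| <= `|h| by rewrite [leRHS]prod_normE le_max lexx.
have h2 : `|h.2| <= `|h| by rewrite [leRHS]prod_normE le_max lexx orbT.
have := mulmx_norm_le h.1 (Dx p)^T; rewrite trmx_norm normrZ => H.
have H1 : n%:R * (`|h.1| * `|Dx p|) <= `|h| * (n%:R * `|Dx p|).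
  by rewrite mulrCA ler_wpM2r.
have H2 : `|h.2| * `|Dt p| <= `|h| * `|Dt p| by rewrite ler_wpM2r.
have := normr_ge0 h.
rewrite /K !mulrDr; lra.
Qed.

Lemma tube_field_continuous (y : R -> V) : continuous y ->
  continuous (fun t => tube_field (y t) t).
Proof.
move=> cy t; apply/continuous_epsP => e e0.
have [d d0 Hd] := C1_continuous (tube_pointP (y t) t) e0.
have /continuous_epsP/(_ _ d0)[d' d'0 Hd'] := @tube_point_continuous _ cy t.
exists (Num.min d d'); first by rewrite lt_min d0.
move=> s; rewrite lt_min => /andP[sd /Hd' sd'].
apply: (Hd (_, _) (tube_pointP (y s) s)).
rewrite pair_norm_lt sd'; apply: le_lt_trans sd; exact: clamp_lipschitz.
Qed.

Lemma tube_jac_continuous : continuous tube_jac.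
Proof.
case: C1F => _ cD _ t; apply/continuous_epsP => e e0.
have [d d0 Hd] := within_continuousP cD (tube_center t) e0.
have /continuous_epsP/(_ _ d0)[d' d'0 Hd'] := @xc_continuous t.
exists (Num.min d d'); first by rewrite lt_min d0.
move=> s; rewrite lt_min => /andP[sd /Hd' sd'].
apply: (Hd (_, _) (tube_center s)).
rewrite pair_norm_lt sd'; apply: le_lt_trans sd; exact: clamp_lipschitz.
Qed.

(** For each time the tube is a ball, hence convex, and the function of the
    segment parameter can be estimated with [increment_le]. Taking E = 0 gives a
    Lipschitz bound, and E the Jacobian at z a second-order Taylor bound. *)
Lemma tube_mean_value t z z' (E : 'M[R]_n) m : a <= t <= b ->
  `|z - x t| <= r -> `|z' - x t| <= r ->
  (forall c, `|c - x t| <= r -> `|c - z| <= `|z' - z| -> `|Dx (c, t) - E| <= m) ->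
  `|F z' t - F z t - (z' - z) *m E^T| <= n%:R * m * `|z' - z|.
Proof.
move=> tab zr zr' HE; set w := z' - z.
have seg th : 0 <= th <= 1 -> `|z + th *: w - x t| <= r.
  move=> th01.
  have -> : z + th *: w - x t = (1 - th) *: (z - x t) + th *: (z' - x t).
    have -> : w = (z' - x t) - (z - x t) by rewrite opprB addrA subrK.
    by rewrite addrAC scalerBr scalerBl scale1r addrA addrAC.
  apply: (le_trans (ler_normD _ _)); rewrite !normrZ !ger0_norm; [|lra|lra].
  have : (1 - th) * `|z - x t| <= (1 - th) * r by rewrite ler_wpM2l //; lra.
  have : th * `|z' - x t| <= th * r by rewrite ler_wpM2l //; lra.
  lra.
pose psi (th : R) : V := F (z + th *: w) t - (th *: w) *m E^T.
suff : `|psi 1 - psi 0| <= n%:R * m * `|w| * (1 - 0).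
  rewrite subr0 mulr1 /psi scale1r scale0r mul0mx subr0 addr0.
  by rewrite {1}/w [z + _]addrC subrK addrAC.
apply: increment_le => // e th e0 th01.
have Ac := tubeA tab (seg _ th01).
case: C1F => dF _ _.
have e'0 : 0 < e / (`|w| + 1) by rewrite divr_gt0 // ltr_wpDl.
have [d d0 Hd] := is_diff_withinP (dF _ Ac) e'0.
exists (d / (`|w| + 1)); first by rewrite divr_gt0 // ltr_wpDl.
move=> th' th'01; rewrite ltr_pdivlMr ?ltr_wpDl // => thd.
pose h := (th' - th) *: w.
have hE : (z + th' *: w, t) - (z + th *: w, t) = (h, 0) :> V * R.
  by congr pair; rewrite /h ?subrr //= scalerBl opprD addrACA subrr add0r.
have nh : `|(h, 0) : V * R| = `|th' - th| * `|w|.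
  by rewrite prod_normE /= normr0 normrZ max_l.
have := Hd (z + th' *: w, t) (tubeA tab (seg _ th'01)); rewrite hE nh /=.
rewrite scale0r addr0 => {}Hd.
have {}Hd := Hd (le_lt_trans (ler_wpM2l (normr_ge0 _) (ltac:(lra) : `|w| <= `|w| + 1)) thd).
have -> : psi th' - psi th = (F (z + th' *: w) t - F (z + th *: w) t -
     h *m (Dx (z + th *: w, t))^T) + h *m (Dx (z + th *: w, t) - E)^T.
  rewrite [(_ - E)^T]linearB /= mulmxBr addrA subrK /psi /h scalerBl mulmxBl.
  by rewrite opprD addrACA -opprD.
apply: (le_trans (ler_normD _ _)).
have H1 : e / (`|w| + 1) * (`|th' - th| * `|w|) <= e * `|th' - th|.
  rewrite mulrCA mulrC ler_wpM2r // mulrAC ler_pdivrMr ?ltr_wpDl //.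
  by rewrite ler_pM2l //; lra.
have HDE : `|Dx (z + th *: w, t) - E| <= m.
  apply: HE; first exact: seg.
  by rewrite addrAC subrr add0r normrZ ger0_norm ?ler_piMl //; lra.
have H2 : `|h *m (Dx (z + th *: w, t) - E)^T| <= n%:R * m * `|w| * `|th' - th|.
  apply: (le_trans (mulmx_norm_le _ _)); rewrite trmx_norm /h normrZ.
  have -> : n%:R * m * `|w| * `|th' - th| = n%:R * (`|th' - th| * `|w| * m) by ring.
  by rewrite !ler_wpM2l // mulr_ge0.
lra.
Qed.

Lemma tube_jacE t : a <= t <= b -> tube_jac t = Dx (x t, t).
Proof. by move=> tab; rewrite /tube_jac /xc clamp_id. Qed.

(** The tube is a neighbourhood of x t for fixed t, so that the derivative
    relative to A is a genuine derivative in the state. *)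
Lemma jac_tube t : a <= t <= b -> jac (fun z => F z t) (x t) = tube_jac t.
Proof.
move=> tab; rewrite tube_jacE //.
have At : A (x t, t) by apply: tubeA => //; rewrite subrr normr0 ltW.
case: C1F => dF _ _.
set D := Dx (x t, t).
have cD : continuous (mulmxr D^T : V -> V).
  move=> z; apply/(@cvgrPdist_le _ _ _ (nbhs z)) => e e0.
  have K0 : 0 < n%:R * `|D| + 1 by rewrite ltr_wpDl.
  near=> z'; rewrite /= -mulmxBl; apply: (le_trans (mulmx_norm_le _ _)).
  rewrite trmx_norm mulrCA.
  apply: (@le_trans _ _ (`|z - z'| * (n%:R * `|D| + 1))); first by rewrite ler_wpM2l // lerDl.
  rewrite -ler_pdivlMr //; near: z'.
  by apply: (@cvgr_dist_le _ _ _ _ _ id) => //; rewrite divr_gt0.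
have dE : 'd (fun z => F z t) (x t) = mulmxr D^T :> (V -> V).
  apply: diff_unique => //; apply/eqaddoP => e e0.
  have [d d0 Hd] := is_diff_withinP (dF _ At) e0.
  near=> h.
  have hd : `|h| < Num.min d r by near: h; apply: (@nbhs0_lt R V); rewrite lt_min d0.
  move: hd; rewrite lt_min => /andP[hd hr].
  have Ah : A (h + x t, t) by apply: tubeA => //; rewrite addrK ltW.
  have := Hd _ Ah.
  have -> : (h + x t, t) - (x t, t) = (h, 0) :> V * R.
    by congr pair; rewrite /= ?subrr ?addrK.
  have -> : `|(h, 0) : V * R| = `|h| by rewrite prod_normE /= normr0 max_l.
  move=> /(_ hd) /=; rewrite scale0r addr0.
  by rewrite !fctE /= opprD addrA.
rewrite /jac /jacobian; apply/(canLR (@trmxK _ _ _))/row_matrixP => i.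
by rewrite !rowE mul_rV_lin1 dE.
Unshelve. all: by end_near. Qed.

(** Dx is bounded along x by continuity and on the tube by its Lipschitz
    property; the bounds on F follow by the mean value inequality. *)
Lemma tube_extension :
  exists M g B, extends_near F x (fun t => a <= t <= b) r M g B.
Proof.
pose g := tube_field; pose B := tube_jac.
have cg := tube_field_continuous.
have cB := tube_jac_continuous.
have cx := xc_continuous.
have [M1 M10 HM1] := continuous_bounded ab cB.
have [M2 M20 HM2] := continuous_bounded ab (cg _ cx).
pose M3 := M1 + `|L| * r.
have M30 : 0 <= M3 by rewrite addr_ge0 // mulr_ge0 // ltW.
have cl t := clamp_itv t ab.
have clK t : clamp a b (clamp a b t) = clamp a b t by rewrite clamp_id.
have HB t : `|B t| <= M1.
  by have := HM1 _ (cl t); rewrite /B /tube_jac /xc clK.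
have LDx' z z' t : A (z, t) -> A (z', t) ->
     `|Dx (z, t) - Dx (z', t)| <= `|L| * `|z - z'|.
  by move=> Az Az'; apply: (le_trans (LDx Az Az')); rewrite ler_wpM2r // ler_norm.
have HD z t : a <= t <= b -> `|z - x t| <= r -> `|Dx (z, t)| <= M3.
  move=> tab zr; rewrite -[Dx _](subrK (Dx (x t, t))); apply: (le_trans (ler_normD _ _)).
  rewrite addrC lerD //; first by rewrite -(tube_jacE tab) HB.
  apply: (le_trans (LDx' _ _ _ _ _)); [exact: tubeA| |].
    by apply: tubeA; rewrite ?subrr ?normr0 // ltW.
  by rewrite ler_wpM2l.
have lipF t z z' : a <= t <= b -> `|z - x t| <= r -> `|z' - x t| <= r ->
    `|F z' t - F z t| <= n%:R * M3 * `|z' - z|.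
  move=> tab zr zr'.
  have := @tube_mean_value t z z' 0 M3 tab zr zr'.
  rewrite trmx0 mulmx0 subr0; apply => c cr _; rewrite subr0.
  exact: HD.
have ptr z t : `|tube_point z t - x (clamp a b t)| <= r.
  by rewrite /tube_point [_ + retract _ _]addrC addrK retract_norm // ltW.
have lipg t z z' : `|g z t - g z' t| <= n%:R * M3 * `|z - z'|.
  apply: (le_trans (lipF _ _ _ (cl t) (ptr z' t) (ptr z t))).
  rewrite ler_wpM2l ?mulr_ge0 // /tube_point opprD addrACA subrr add0r.
  apply: (le_trans (retract_lipschitz _ _ (ltW r0))).
  by rewrite opprD addrACA subrr addr0.
have gE z t : a <= t <= b -> `|z - x t| <= r -> g z t = F z t.
  by move=> tab zr; rewrite /g /tube_field (tube_point_id tab zr) clamp_id.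
have Hg z t : `|g z t| <= M2 + n%:R * M3 * r.
  have gcl : g z t = g (tube_point z t) (clamp a b t).
    by rewrite [RHS]gE.
  rewrite gcl; set z' := tube_point _ _.
  rewrite -[g z' _](subrK (g (x (clamp a b t)) (clamp a b t))).
  apply: (le_trans (ler_normD _ _)); rewrite addrC lerD //.
    by have := HM2 _ (cl t); rewrite /xc clK.
  apply: (le_trans (lipg _ _ _)); rewrite ler_wpM2l ?mulr_ge0 //.
  exact: ptr.
pose M := M1 + (n%:R * M3 + (M2 + n%:R * M3 * r + n%:R * `|L|)).
have p1 : 0 <= n%:R * M3 by rewrite mulr_ge0.
have p2 : 0 <= n%:R * M3 * r by rewrite mulr_ge0 // ltW.
have p3 : 0 <= n%:R * `|L| by rewrite mulr_ge0.
exists M, g, B; split => //.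
- move=> t z z'; apply: (le_trans (lipg _ _ _)).
  by rewrite ler_wpM2r // /M; lra.
- by move=> z t; apply: (le_trans (Hg _ _)); rewrite /M; lra.
- by move=> t; apply: (le_trans (HB _)); rewrite /M; lra.
- move=> z t tab zr.
  have xr : `|x t - x t| <= r by rewrite subrr normr0 ltW.
  rewrite !gE //.
  have H := @tube_mean_value t (x t) z (B t) (`|L| * `|z - x t|) tab xr zr.
  apply: (le_trans (H _)).
    move=> c cr cz; rewrite /B tube_jacE //.
    apply: (le_trans (LDx' _ _ _ _ _)); [exact: tubeA|exact: tubeA|].
    by rewrite ler_wpM2l.
  rewrite mulrA -mulrA -expr2 ler_wpM2r ?exprn_ge0 // /M; lra.
- by move=> t tab; apply: (jac_tube tab).
Qed.

End Tube.

Lemma finite_lower_bound (R : realType) (I : finType) (P : I -> R -> Prop) :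
  (forall i, exists2 d, 0 < d & P i d) ->
  (forall i d d', 0 < d' -> d' <= d -> P i d -> P i d') ->
  exists2 d, 0 < d & forall i, P i d.
Proof.
move=> H mono.
have Hex i : exists d, 0 < d /\ P i d by have [d] := H i; exists d.
have [d Hd] := choice Hex.
have d0 : 0 < \big[Num.min/1]_(i : I) d i.
  by elim/big_ind: _ => // [u v u0 v0|i _]; [rewrite lt_min u0 | have [] := Hd i].
exists (\big[Num.min/1]_(i : I) d i) => // i; have [_ Pi] := Hd i.
by apply: mono Pi => //; exact: bigmin_le_cond.
Qed.

(** The tubes extend beyond the pieces (s_j, s_{j+1}) on both sides by a common
    margin d, and finitely many bounds have a common upper bound. *)
Lemma state_regularity_extension (R : realType) (n k : nat) (N : 'rV[R]_n -> R)
    (T : R) (fs : 'I_k.+1 -> 'rV[R]_n -> R -> 'rV[R]_n) (s : 'rV[R]_k)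
    (x : R -> 'rV[R]_n) :
  is_norm N -> switching_points T s -> abs_continuous 0 T x ->
  state_regularity N T fs s x ->
  exists (r d M : R) gs Bs, [/\ 0 < r, 0 < d, 0 <= M &
    forall j : 'I_k.+1, extends_near (fs j) x
      (fun t => 0 <= t <= T /\ knot T s j - d <= t <= knot T s j.+1 + d)
      r M (gs j) (Bs j)].
Proof.
move=> normN sT acx [rho [sm [sp [L [rho0 gaps Hj]]]]].
have [K K0 HK] := norm_le_sup normN.
pose r := rho / K; have r0 : 0 < r by rewrite divr_gt0.
have smE (j : 'I_k.+1) : knot T sm j <= knot T s j /\ 0 <= knot T sm j.
  have [j0|jpos] := posnP j; first by rewrite j0.
  have jk : (0 < j <= k)%N by rewrite jpos -ltnS ltn_ord.
  have [/andP[h1 h2] _] := gaps j jk; split; first exact: ltW.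
  apply: (le_trans _ (ltW h1)); apply: (@knot_le _ _ _ _ sT 0 j.-1).
  by have /andP[_ /leqW/(leq_trans (leq_pred j))] := jk.
have spE (j : 'I_k.+1) : knot T s j.+1 <= knot T sp j.+1 /\ knot T sp j.+1 <= T.
  have jk := ltn_ord j; rewrite ltnS leq_eqVlt in jk.
  case/orP: jk => [/eqP ->|jk]; first by rewrite !knot_last.
  have := gaps j.+1 => /(_ jk)[_ /andP[h1 h2]]; split; first exact: ltW.
  apply: (le_trans (ltW h2)); rewrite -[leRHS](@knot_last _ _ T s).
  by apply: knot_le => //; rewrite ltnS jk leqnn.
have [d d0 Hd] : exists2 d, 0 < d & forall j : 'I_k.+1,
    forall t, 0 <= t <= T -> knot T s j - d <= t <= knot T s j.+1 + d ->
      knot T sm j <= t <= knot T sp j.+1.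
  apply: (@finite_lower_bound _ _ (fun (j : 'I_k.+1) d => forall t,
      0 <= t <= T -> knot T s j - d <= t <= knot T s j.+1 + d ->
      knot T sm j <= t <= knot T sp j.+1)); last first.
    by move=> j d d' d'0 dd' H t tT tj; apply: H => //; lra.
  move=> j.
  have [d1 d10 H1] : exists2 d, 0 < d &
      forall t, 0 <= t -> knot T s j - d <= t -> knot T sm j <= t.
    have [j0|jpos] := posnP j; first by exists 1; rewrite // j0.
    have jk : (0 < j <= k)%N by rewrite jpos -ltnS ltn_ord.
    have [/andP[h1 h2] _] := gaps j jk.
    by exists (knot T s j - knot T sm j); rewrite ?subr_gt0 // => t _; lra.
  have [d2 d20 H2] : exists2 d, 0 < d &
      forall t, t <= T -> t <= knot T s j.+1 + d -> t <= knot T sp j.+1.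
    have jk := ltn_ord j; rewrite ltnS leq_eqVlt in jk.
    case/orP: jk => [/eqP ->|jk]; first by exists 1; rewrite ?knot_last.
    have := gaps j.+1 => /(_ jk)[_ /andP[h1 h2]].
    by exists (knot T sp j.+1 - knot T s j.+1); rewrite ?subr_gt0 // => t _; lra.
  exists (Num.min d1 d2); first by rewrite lt_min d10.
  move=> t /andP[t0 tT] /andP[h1 h2].
  have m1 : Num.min d1 d2 <= d1 by rewrite ge_min lexx.
  have m2 : Num.min d1 d2 <= d2 by rewrite ge_min lexx orbT.
  by rewrite H1 ?H2 //; lra.
have ext (j : 'I_k.+1) : exists Mg : R * ('rV[R]_n -> R -> 'rV[R]_n) * (R -> 'M[R]_n),
    extends_near (fs j) x
      (fun t => 0 <= t <= T /\ knot T s j - d <= t <= knot T s j.+1 + d)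
      r Mg.1.1 Mg.1.2 Mg.2.
  have [h1 h2] := smE j; have [h3 h4] := spE j.
  have [Dx [Dt [C1F LDx]]] := Hj j.
  have kk : knot T s j <= knot T s j.+1 by apply/ltW/sT; rewrite -ltnS ltn_ord.
  have jj : knot T sm j <= knot T sp j.+1 by lra.
  have acj : abs_continuous (knot T sm j) (knot T sp j.+1) x by exact: ac_sub acx.
  have tubeA z t : knot T sm j <= t <= knot T sp j.+1 -> `|z - x t| <= r ->
      tube N x rho (knot T sm j) (knot T sp j.+1) (z, t).
    move=> tab zr; split=> //=; apply: (le_trans (HK _)).
    by rewrite mulrC -ler_pdivlMr.
  have [M [g [B H]]] := tube_extension jj r0 acj tubeA C1F
    (fun z z' t Az Az' => LDx t (z, z') (conj Az Az')).
  exists (M, g, B); apply: extends_near_weaken H => // t [tT tj].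
  exact: Hd.
have [W HW] := choice ext.
exists r, d, (\sum_(j < k.+1) `|(W j).1.1|), (fun j => (W j).1.2), (fun j => (W j).2).
split=> //; first exact: sumr_ge0.
move=> j; apply: extends_near_weaken (HW j) => //.
rewrite (bigD1 j) //=; apply: (le_trans (ler_norm _)); rewrite lerDl.
exact: sumr_ge0.
Qed.

(** * Moving one switching time *)

Section KnotPerturbation.
Variables (R : realType) (k : nat) (T : R) (s : 'rV[R]_k) (j : 'I_k).
Hypothesis sT : switching_points T s.
Local Notation shifted h := (s + h *: delta_mx 0 j).

Lemma knot_shift h i :
  knot T (shifted h) i = knot T s i + (if i == j.+1 then h else 0).
Proof.
case: i => [|i] /=; first by rewrite addr0.
rewrite eqSS; case: insubP => [l _ <-|ik] /=.
  rewrite !mxE eqxx /=; congr (_ + _).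
  by rewrite val_eqE; case: eqP => _; rewrite ?mulr1 ?mulr0.
by rewrite (gtn_eqF (leq_trans (ltn_ord j) _)) ?addr0 // leqNgt.
Qed.

Lemma gap_lower_bound : exists2 d, 0 < d &
  forall i, (i <= k)%N -> knot T s i + d < knot T s i.+1.
Proof.
have [d d0 Hd] : exists2 d, 0 < d & forall i : 'I_k.+1, knot T s i + d < knot T s i.+1.
  apply: (@finite_lower_bound R 'I_k.+1
    (fun i d => knot T s i + d < knot T s i.+1)) => [i|i d d' d'0 dd' H]; last lra.
  have si := sT (ltn_ord i : (i <= k)%N).
  by exists ((knot T s i.+1 - knot T s i) / 2); lra.
by exists d => // i ik; exact: (Hd (Ordinal (ik : (i < k.+1)%N))).
Qed.

Lemma switching_shift d h :
  (forall i, (i <= k)%N -> knot T s i + d < knot T s i.+1) -> `|h| < d ->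
  switching_points T (shifted h).
Proof.
rewrite ltr_norml => gap hd i ik; have := gap i ik; rewrite !knot_shift.
by case: eqP => [->|_]; case: eqP => [e|_]; lra.
Qed.

Definition shift_lo h := Num.min (knot T s j.+1) (knot T s j.+1 + h).
Definition shift_hi h := Num.max (knot T s j.+1) (knot T s j.+1 + h).

Lemma shift_bounds d h :
  (forall i, (i <= k)%N -> knot T s i + d < knot T s i.+1) -> `|h| < d ->
  [/\ knot T s j < shift_lo h, shift_lo h <= shift_hi h,
      shift_hi h < knot T s j.+2 & shift_hi h - shift_lo h = `|h|].
Proof.
rewrite ltr_norml => gap hd.
have jk := ltn_ord j.
have := gap j (ltnW jk); have := gap j.+1 jk; rewrite /shift_lo /shift_hi.
move=> g1 g2; case: (leP (knot T s j.+1) (knot T s j.+1 + h)) => H.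
  have h0 : 0 <= h by lra.
  by rewrite ger0_norm //; split; lra.
have h0 : h < 0 by lra.
by rewrite ltr0_norm //; split; lra.
Qed.

Lemma piece_outside h t (i : nat) :
  knot T s i < t < knot T s i.+1 -> t < shift_lo h \/ shift_hi h < t ->
  knot T (shifted h) i < t < knot T (shifted h) i.+1.
Proof.
rewrite /shift_lo /shift_hi lt_min gt_max !knot_shift => ti tout.
have [ei|_] := eqVneq i j.+1; have [ei'|_] := eqVneq i.+1 j.+1.
- by move: ei'; rewrite ei => /esym/n_Sn.
- by rewrite ei in ti *; case: tout => /andP[]; lra.
- by rewrite ei' in ti *; case: tout => /andP[]; lra.
- lra.
Qed.

(** For h > 0 the perturbed problem switches later, so that between the two times
    it is still in piece j while the original one is in piece j + 1; for h <= 0 the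
    roles are exchanged. *)
Lemma piece_inside d h t :
  (forall i, (i <= k)%N -> knot T s i + d < knot T s i.+1) -> `|h| < d ->
  shift_lo h < t < shift_hi h ->
  if 0 < h then knot T s j.+1 < t < knot T s j.+2 /\
     knot T (shifted h) j < t < knot T (shifted h) j.+1
  else knot T s j < t < knot T s j.+1 /\
     knot T (shifted h) j.+1 < t < knot T (shifted h) j.+2.
Proof.
move=> gap hd; have jk := ltn_ord j.
have := gap j (ltnW jk); have := gap j.+1 jk; rewrite !knot_shift.
rewrite eqxx (gtn_eqF (ltnSn j.+1)) (ltn_eqF (ltnSn j)) !addr0.
move: hd; rewrite ltr_norml /shift_lo /shift_hi => hd g1 g2.
case: (leP (knot T s j.+1) (knot T s j.+1 + h)); case: (ltP 0 h) => ? ? ?;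
  by split; lra.
Qed.

End KnotPerturbation.

(** * The pairing of a row vector with a state *)

Section Pairing.
Variables (R : realType) (n : nat).
Local Notation V := 'rV[R]_n.

Definition pairing (p w : V) : R := (p *m w^T) 0 0.

Lemma pairingE p w : pairing p w = \sum_(i < n) p 0 i * w 0 i.
Proof. by rewrite /pairing mxE; apply: eq_bigr => i _; rewrite mxE. Qed.

Lemma pairing_norm p w : `|pairing p w| <= n%:R * (`|p| * `|w|).
Proof.
by apply: (le_trans (coord_norm_le _ _ _)); rewrite -(trmx_norm w) mulmx_norm_le.
Qed.

Lemma pairingBl p p' w : pairing (p - p') w = pairing p w - pairing p' w.
Proof. by rewrite /pairing mulmxBl !mxE. Qed.

Lemma pairingBr p w w' : pairing p (w - w') = pairing p w - pairing p w'.
Proof. by rewrite /pairing linearB /= mulmxBr !mxE. Qed.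

Lemma pairing_adjoint p w (B : 'M[R]_n) : pairing (p *m B) w = pairing p (w *m B^T).
Proof. by rewrite /pairing trmx_mul trmxK mulmxA. Qed.

Lemma is_derive_pairing (p w : R -> V) (dp dw : V) (t : R) :
  is_derive t (1 : R) p dp -> is_derive t (1 : R) w dw ->
  is_derive t (1 : R) (fun t => pairing (p t) (w t))
    (pairing dp (w t) + pairing (p t) dw).
Proof.
move=> Hp Hw.
have -> : (fun t => pairing (p t) (w t)) = \sum_(i < n) (fun t => p t 0 i * w t 0 i).
  by apply/funext => r; rewrite pairingE fct_sumE.
have -> : pairing dp (w t) + pairing (p t) dw =
    \sum_(i < n) (p t 0 i *: dw 0 i + w t 0 i *: dp 0 i).
  rewrite !pairingE -big_split /=; apply: eq_bigr => i _.
  by rewrite addrC /GRing.scale /= [w t 0 i * _]mulrC.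
apply: is_derive_sum => i.
have := is_derive_coord i Hp; have := is_derive_coord i Hw.
by move=> H1 H2; exact: is_deriveM.
Qed.

Lemma pairing_lipschitz a b (p w : R -> V) Kp Kw P W :
  0 <= Kp -> 0 <= Kw ->
  lipschitz_on_itv a b Kp p -> lipschitz_on_itv a b Kw w ->
  (forall t, a <= t <= b -> `|p t| <= P) -> (forall t, a <= t <= b -> `|w t| <= W) ->
  lipschitz_on_itv a b (n%:R * (Kp * W + P * Kw)) (fun t => pairing (p t) (w t)).
Proof.
move=> Kp0 Kw0 Lp Lw HP HW u v uab vab.
have -> : pairing (p v) (w v) - pairing (p u) (w u) =
    pairing (p v - p u) (w v) + pairing (p u) (w v - w u).
  by rewrite pairingBl pairingBr addrA subrK.
apply: (le_trans (ler_normD _ _)).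
apply: (le_trans (lerD (pairing_norm _ _) (pairing_norm _ _))).
rewrite -mulrDr -mulrA ler_wpM2l // mulrDl lerD //.
  by rewrite mulrAC ler_pM // ?Lp ?HW.
by rewrite -mulrA ler_pM // ?HP ?Lw.
Qed.

End Pairing.

Lemma mulmx_continuous (R : realType) (m n p : nat) (A : R -> 'M[R]_(m, n))
    (B : R -> 'M[R]_(n, p)) :
  continuous A -> continuous B -> continuous (fun t => A t *m B t).
Proof.
move=> cA cB t; apply/continuous_epsP => e e0.
pose K := n%:R * (`|A t| + `|B t| + 1) + 1.
have K0 : 0 < K by rewrite ltr_wpDl // mulr_ge0 // !addr_ge0.
have eK : 0 < e / (2 * K) by rewrite divr_gt0 // mulr_gt0.
have /continuous_epsP/(_ _ eK)[d d0 Hd] := cA t.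
have m0 : 0 < Num.min 1 (e / (2 * K)) by rewrite lt_min ltr01.
have /continuous_epsP/(_ _ m0)[d' d'0 Hd'] := cB t.
exists (Num.min d d'); first by rewrite lt_min d0.
move=> s; rewrite lt_min => /andP[/Hd Hs /Hd']; rewrite lt_min => /andP[HB1 HBe].
have -> : A s *m B s - A t *m B t = (A s - A t) *m B s + A t *m (B s - B t).
  by rewrite mulmxBl mulmxBr addrA subrK.
have HBs : `|B s| <= `|B t| + 1.
  by rewrite -[B s](subrK (B t)) addrC (le_trans (ler_normD _ _)) // lerD2l ltW.
apply: (le_lt_trans (ler_normD _ _)).
apply: (le_lt_trans (lerD (mulmx_norm_le _ _) (mulmx_norm_le _ _))).
apply: (@le_lt_trans _ _ (K * (e / (2 * K)))); last first.
  have -> : K * (e / (2 * K)) = e / 2 by field; rewrite gt_eqF.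
  by lra.
rewrite -mulrDr /K mulrDl mul1r.
apply: (@le_trans _ _ (n%:R * (`|A t| + `|B t| + 1) * (e / (2 * K)))); last by rewrite lerDl ltW.
rewrite -mulrA ler_wpM2l //.
have H1 : `|A s - A t| * `|B s| <= e / (2 * K) * (`|B t| + 1) by rewrite ler_pM // ltW.
have H2 : `|A t| * `|B s - B t| <= `|A t| * (e / (2 * K)) by rewrite ler_wpM2l // ltW.
lra.
Qed.

(** * Perturbed trajectories and the costate *)

Section Perturbation.
Variables (R : realType) (n k : nat) (T : R) (x0 : 'rV[R]_n).
Variables (fs gs : 'I_k.+1 -> 'rV[R]_n -> R -> 'rV[R]_n) (Bs : 'I_k.+1 -> R -> 'M[R]_n).
Variables (s : 'rV[R]_k) (x : R -> 'rV[R]_n) (r d M : R).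
Variable C : 'rV[R]_n -> R.
Local Notation V := 'rV[R]_n.
Local Notation mu := (@lebesgue_measure R).
Hypotheses (sT : switching_points T s) (r0 : 0 < r) (d0 : 0 < d) (M0 : 0 <= M).
Hypothesis gap : forall i, (i <= k)%N -> knot T s i + d < knot T s i.+1.
Hypothesis ext : forall j : 'I_k.+1, extends_near (fs j) x
  (fun t => 0 <= t <= T /\ knot T s j - d <= t <= knot T s j.+1 + d)
  r M (gs j) (Bs j).
Hypothesis solx : state_solution T x0 fs s x.

Lemma time_pos : 0 <= T.
Proof.
by have := knot_itv sT (leqnn k.+1); rewrite knot_last; lra.
Qed.

Lemma piece_time (j : 'I_k.+1) t :
  knot T s j <= t <= knot T s j.+1 -> 0 <= t <= T.
Proof.
have := knot_itv sT (ltnW (ltn_ord j)).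
have := knot_itv sT (ltn_ord j : (j.+1 <= k.+1)%N).
lra.
Qed.

Lemma jac_piece (j : 'I_k.+1) t : knot T s j < t < knot T s j.+1 ->
  jac (fun z => switched T fs s z t) (x t) = Bs j t.
Proof.
move=> tj.
have -> : (fun z => switched T fs s z t) = (fun z => fs j z t).
  by apply/funext => z; exact: switchedE.
apply: (ext_jac (ext j)); split; last by have := d0; lra.
by apply: (@piece_time j); lra.
Qed.

Lemma costate_ae p : costate_solution T fs C s x p ->
  {ae mu, forall t : R, 0 < t < T -> exists j : 'I_k.+1,
    knot T s j < t < knot T s j.+1 /\ is_derive t (1 : R) p (- (p t *m Bs j t))}.
Proof.
move=> [_ aep _].
have pieces : {ae mu, forall t : R, 0 < t < T -> exists j : 'I_k.+1,
    knot T s j < t < knot T s j.+1}.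
  apply: (@ae_switched _ k _ s (fun t => exists j : 'I_k.+1,
    knot T s j < t < knot T s j.+1)) => j t tj.
  by exists j.
apply: (ae_imply2 aep pieces) => t H Hj tT.
by have [j tj] := Hj tT; exists j; split=> //; rewrite -(jac_piece tj); exact: H.
Qed.

(** The costate equation is a switched linear equation solved backwards from T. *)
Lemma costate_exists : exists p, costate_solution T fs C s x p.
Proof.
pose cs (j : 'I_k.+1) (p : V) t := - (p *m Bs j t).
have cc j (p : R -> V) : continuous p -> continuous (fun t => cs j (p t) t).
  move=> cp t; apply: cvgN; apply: mulmx_continuous => //.
  exact: (ext_jac_continuous (ext j)).
have lc j t p p' : `|cs j p t - cs j p' t| <= n%:R * M * `|p - p'|.
  rewrite /cs -opprD normrN -mulmxBl; apply: (le_trans (mulmx_norm_le _ _)).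
  rewrite -mulrA ler_wpM2l // mulrC ler_wpM2r //.
  exact: (ext_jac_bounded (ext j)).
have nM0 : 0 <= n%:R * M by rewrite mulr_ge0.
have [_ [p [[K LK] aep] pT]] :=
  solvable_switched sT nM0 cc lc (row_grad C (x T)).
exists p; split => //; first exact: lipschitz_ac LK.
have E : {ae mu, forall t : R, 0 < t < T -> switched T cs s (p t) t =
    - (p t *m jac (fun z => switched T fs s z t) (x t))}.
  apply: (@ae_switched _ k _ s (fun t => switched T cs s (p t) t =
    - (p t *m jac (fun z => switched T fs s z t) (x t)))) => j t tj.
  by rewrite (jac_piece tj) (switchedE sT _ _ tj).
by apply: (ae_imply2 aep E) => t H1 H2 tT; rewrite -H2 //; exact: H1.
Qed.

Lemma costate_derivative_bound (p q : V) t (j : 'I_k.+1) :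
  `|p *m Bs j t - q *m Bs j t| <= n%:R * M * `|p - q|.
Proof.
rewrite -mulmxBl; apply: (le_trans (mulmx_norm_le _ _)).
rewrite -mulrA ler_wpM2l // mulrC ler_wpM2r //.
exact: (ext_jac_bounded (ext j)).
Qed.

Lemma costate_unique p q : costate_solution T fs C s x p ->
  costate_solution T fs C s x q -> forall t, 0 <= t <= T -> q t = p t.
Proof.
move=> [acp aep pT] [acq aeq qT] t tT.
have nM0 : 0 <= n%:R * M by rewrite mulr_ge0.
have T0 := time_pos.
have [G G1 HG] := gronwall V T0 nM0.
apply/eqP; rewrite -subr_eq0 -normr_le0.
have -> : 0 = G * `|q T - p T| by rewrite pT qT subrr normr0 mulr0.
apply: (HG 0 T (fun t => q t - p t)) => //; [exact: acB| |by rewrite lexx andbT].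
have pieces : {ae mu, forall t : R, 0 < t < T -> exists j : 'I_k.+1,
    jac (fun z => switched T fs s z t) (x t) = Bs j t}.
  apply: (@ae_switched _ k _ s (fun t => exists j : 'I_k.+1,
    jac (fun z => switched T fs s z t) (x t) = Bs j t)) => j a aj.
  by exists j; exact: jac_piece.
have aepq := ae_imply2 aep aeq (fun t => @conj _ _).
apply: (ae_imply2 aepq pieces) => a [Hp Hq] Hj aT.
have [j Ej] := Hj aT; have {}Hp := Hp aT; have {}Hq := Hq aT.
rewrite Ej in Hp Hq.
exists (- (q a *m Bs j a) - - (p a *m Bs j a)); first exact: is_deriveB.
by rewrite -opprD normrN costate_derivative_bound.
Qed.

Lemma costate_lipschitz p : costate_solution T fs C s x p ->
  exists P, [/\ 0 <= P, forall t, 0 <= t <= T -> `|p t| <= P &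
    lipschitz_on_itv 0 T (n%:R * M * P) p].
Proof.
move=> solp; have [acp _ _] := solp.
have T0 := time_pos.
have [P P0 HP] := ac_bounded T0 acp.
exists P; split=> //; apply: ac_lipschitz => //; first by rewrite !mulr_ge0.
apply: (ae_imply (costate_ae solp)) => t H tT.
have [j [_ Hj]] := H tT; exists (- (p t *m Bs j t)) => //.
rewrite normrN; have := costate_derivative_bound (p t) 0 t j.
rewrite mul0mx !subr0 => /le_trans; apply.
by rewrite ler_wpM2l ?mulr_ge0 // HP //; lra.
Qed.

Variable l : 'I_k.
Local Notation shifted h := (s + h *: delta_mx 0 l).

Lemma shifted_piece_time h (j : 'I_k.+1) t : `|h| < d ->
  knot T (shifted h) j < t < knot T (shifted h) j.+1 ->
  0 <= t <= T /\ knot T s j - d <= t <= knot T s j.+1 + d.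
Proof.
move=> hd tj; have sT' := switching_shift l gap hd.
split.
  have := knot_itv sT' (ltnW (ltn_ord j)).
  have := knot_itv sT' (ltn_ord j : (j.+1 <= k.+1)%N).
  lra.
move: tj hd; rewrite !knot_shift ltr_norml; case: eqP => _; case: eqP => _; lra.
Qed.

Lemma ae_piece (P : R -> Prop) h : `|h| < d ->
  (forall (j : 'I_k.+1) t, knot T (shifted h) j < t < knot T (shifted h) j.+1 ->
    0 <= t <= T -> knot T s j - d <= t <= knot T s j.+1 + d -> P t) ->
  {ae mu, forall t : R, 0 < t < T -> P t}.
Proof.
move=> hd H; apply: (@ae_switched _ _ _ _ P) => j t tj.
by have [tT td] := shifted_piece_time hd tj; exact: H tT td.
Qed.

Lemma x_near t : `|x t - x t| <= r.
Proof. by rewrite subrr normr0 ltW. Qed.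

Lemma shifted0 : shifted 0 = s.
Proof. by rewrite scale0r addr0. Qed.

(** As long as the trajectory stays in the thinner tubes, f_j and g_j prescribe
    the same equation. *)
Lemma state_solution_ext h y : `|h| < d ->
  (forall t, 0 <= t <= T -> `|y t - x t| <= r) ->
  state_solution T x0 gs (shifted h) y <-> state_solution T x0 fs (shifted h) y.
Proof.
move=> hd yx.
have eqsw : {ae mu, forall t : R, 0 < t < T ->
    switched T gs (shifted h) (y t) t = switched T fs (shifted h) (y t) t}.
  apply: (ae_piece hd) => j t tj tT td.
  have sT' := switching_shift l gap hd.
  by rewrite !(switchedE sT' _ _ tj) (ext_eq (ext j)) // yx.
split=> -[acy aey y0]; split=> //.
  by apply: (ae_imply2 aey eqsw) => t H1 H2 tT; rewrite -H2 //; exact: H1.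
by apply: (ae_imply2 aey eqsw) => t H1 H2 tT; rewrite H2 //; exact: H1.
Qed.

Lemma ext_solution_x : state_solution T x0 gs s x.
Proof.
rewrite -shifted0; apply/state_solution_ext; rewrite ?normr0 ?shifted0 //.
by move=> t _; exact: x_near.
Qed.

Lemma ext_solution_lipschitz h y : `|h| < d ->
  state_solution T x0 gs (shifted h) y -> lipschitz_on_itv 0 T M y.
Proof.
move=> hd [acy aey _]; have sT' := switching_shift l gap hd.
apply: ac_lipschitz => //.
have bnd : {ae mu, forall t : R, 0 < t < T ->
    `|switched T gs (shifted h) (y t) t| <= M}.
  apply: (ae_piece hd) => j t tj _ _.
  rewrite (switchedE sT' _ _ tj).
  exact: (ext_bounded (ext j)).
apply: (ae_imply2 aey bnd) => t H1 H2 tT.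
by exists (switched T gs (shifted h) (y t) t); [exact: H1 | exact: H2].
Qed.

Lemma ext_x_lipschitz : lipschitz_on_itv 0 T M x.
Proof.
apply: (@ext_solution_lipschitz 0); rewrite ?normr0 //.
by rewrite shifted0; exact: ext_solution_x.
Qed.

Lemma ext_solution_exists h : `|h| < d ->
  exists y, state_solution T x0 gs (shifted h) y.
Proof.
move=> hd; have sT' := switching_shift l gap hd.
have cg j (z : R -> V) : continuous z -> continuous (fun t => gs j (z t) t).
  exact: (ext_continuous (ext j)).
have lg j t z z' : `|gs j z t - gs j z' t| <= M * `|z - z'|.
  exact: (ext_lipschitz (ext j)).
have [[y [[K LK] aey] y0] _] := solvable_switched sT' M0 cg lg x0.
by exists y; split => //; exact: lipschitz_ac LK.
Qed.

Local Notation lo := (shift_lo T s l).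
Local Notation hi := (shift_hi T s l).

Lemma ae_outside h y : `|h| < d -> state_solution T x0 gs (shifted h) y ->
  {ae mu, forall t : R, 0 < t < T -> t < lo h \/ hi h < t ->
     exists j : 'I_k.+1,
     [/\ knot T s j < t < knot T s j.+1,
         0 <= t <= T /\ knot T s j - d <= t <= knot T s j.+1 + d,
         is_derive t (1 : R) y (gs j (y t) t)
       & is_derive t (1 : R) x (gs j (x t) t)]}.
Proof.
move=> hd [_ aey _]; have [_ aex _] := ext_solution_x.
have sT' := switching_shift l gap hd.
have pieces : {ae mu, forall t : R, 0 < t < T -> t < lo h \/ hi h < t ->
    exists j : 'I_k.+1,
     [/\ knot T s j < t < knot T s j.+1,
         0 <= t <= T /\ knot T s j - d <= t <= knot T s j.+1 + d,
         forall z, switched T gs (shifted h) z t = gs j z t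
       & forall z, switched T gs s z t = gs j z t]}.
  apply: (@ae_switched _ _ _ _ (fun t => t < lo h \/ hi h < t -> _)) => // j t tj tout.
  have tj' := piece_outside tj tout.
  exists j; split=> //; first exact: (shifted_piece_time hd tj').
    by move=> z; exact: switchedE.
  by move=> z; exact: switchedE.
have aeyx := ae_imply2 aey aex (fun t => @conj _ _).
apply: (ae_imply2 aeyx pieces) => t [Hy Hx] Hp tT tout.
have [j [js tj Ey Ex]] := Hp tT tout; exists j; split => //.
  by rewrite -Ey; exact: Hy.
by rewrite -Ex; exact: Hx.
Qed.

(** The pieces that the perturbed and the original trajectory are in between the
    old and the new switching time. *)
Definition new_piece (h : R) : 'I_k.+1 :=
  if 0 < h then widen_ord (leqnSn k) l else lift ord0 l.
Definition old_piece (h : R) : 'I_k.+1 :=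
  if 0 < h then lift ord0 l else widen_ord (leqnSn k) l.

Lemma ae_inside h y : `|h| < d -> state_solution T x0 gs (shifted h) y ->
  {ae mu, forall t : R, lo h < t < hi h ->
     is_derive t (1 : R) y (gs (new_piece h) (y t) t) /\
     is_derive t (1 : R) x (gs (old_piece h) (x t) t)}.
Proof.
move=> hd [_ aey _]; have [_ aex _] := ext_solution_x.
have sT' := switching_shift l gap hd.
apply: (ae_imply2 aey aex) => t Hy Hx tlh.
have lk := ltn_ord l.
have [b1 b2 b3 _] := shift_bounds l gap hd.
have k1 := knot_itv sT (leqW (ltnW lk)).
have k2 := knot_itv sT (lk : (l.+2 <= k.+1)%N).
have tT : 0 < t < T by lra.
have := piece_inside gap hd tlh.
rewrite /new_piece /old_piece; case: ifP => h0 [p1 p2].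
- have E1 := switchedE (j := widen_ord (leqnSn k) l) sT' gs (y t) p2.
  have E2 := switchedE (j := lift ord0 l) sT gs (x t) p1.
  by split; [rewrite -E1; exact: Hy | rewrite -E2; exact: Hx].
- have E1 := switchedE (j := lift ord0 l) sT' gs (y t) p2.
  have E2 := switchedE (j := widen_ord (leqnSn k) l) sT gs (x t) p1.
  by split; [rewrite -E1; exact: Hy | rewrite -E2; exact: Hx].
Qed.

(** The trajectories coincide before the perturbed interval, separate at speed at
    most 2 M during it, that is by at most 2 M |h|, and the Gronwall inequality
    controls what follows. *)
Lemma perturbed_close : exists2 K, 0 <= K & forall h y, `|h| < d ->
  state_solution T x0 gs (shifted h) y ->
  (forall t, 0 <= t <= lo h -> y t = x t) /\
  (forall t, 0 <= t <= T -> `|y t - x t| <= K * `|h|).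
Proof.
have [G G1 HG] := gronwall V time_pos M0.
exists (G * (2 * M)); first by rewrite !mulr_ge0 //; lra.
move=> h y hd soly; have [acy _ y0] := soly; have [acx _ xx0] := solx.
have Ly := ext_solution_lipschitz hd soly.
have Lx := ext_x_lipschitz.
have lk := ltn_ord l.
have [b1 b2 b3 b4] := shift_bounds l gap hd.
have k1 := knot_itv sT (leqW (ltnW lk)).
have k2 := knot_itv sT (lk : (l.+2 <= k.+1)%N).
pose w t := y t - x t.
have acw : abs_continuous 0 T w by exact: acB.
have aew : {ae mu, forall t : R, 0 < t < T -> t < lo h \/ hi h < t ->
     exists2 dw, is_derive t (1 : R) w dw & `|dw| <= M * `|w t|}.
  apply: (ae_imply (ae_outside hd soly)) => t H tT tout.
  have [j [_ _ Hy Hx]] := H tT tout.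
  exists (gs j (y t) t - gs j (x t) t); first exact: is_deriveB.
  exact: (ext_lipschitz (ext j)).
have w_lo t : 0 <= t <= lo h -> w t = 0.
  move=> tlo; apply/eqP; rewrite -normr_le0.
  have := HG 0 (lo h) w; move=> /(_ (lexx _) _ _ _ _ t 0) H.
  have -> : 0 = G * `|w 0| by rewrite /w y0 xx0 subrr normr0 mulr0.
  apply: H; [lra|lra|by apply: ac_sub acw; lra| |exact: tlo|lra].
  by apply: (ae_imply aew) => u H tu; apply: H; [lra|left; lra].
have w_mid t : lo h <= t <= hi h -> `|w t| <= 2 * M * `|h|.
  move=> tlh; rewrite -[w t]subr0 -(w_lo (lo h)); last lra.
  rewrite /w opprD addrACA -opprD; apply: (le_trans (ler_normB _ _)).
  have tl : `|t - lo h| = t - lo h by rewrite ger0_norm // subr_ge0; lra.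
  have := Ly (lo h) t; have := Lx (lo h) t; rewrite -b4 tl.
  have : M * (t - lo h) <= M * (hi h - lo h) by rewrite ler_wpM2l //; lra.
  move=> H1 H2 H3; have {}H2 := H2 ltac:(lra) ltac:(lra).
  have {}H3 := H3 ltac:(lra) ltac:(lra); lra.
have Kh : 2 * M * `|h| <= G * (2 * M) * `|h|.
  by rewrite ler_wpM2r // ler_peMl // mulr_ge0.
split=> [t tlo|t tT].
  by apply/eqP; rewrite -subr_eq0; apply/eqP; exact: w_lo.
rewrite -/(w t); have [tlo|/ltW lot] := leP t (lo h).
  by rewrite w_lo ?normr0 ?mulr_ge0 //; lra.
have [thi|/ltW hit] := leP t (hi h).
  by apply: (le_trans (w_mid _ _)) => //; rewrite lot.
have := HG (hi h) T w; move=> /(_ _ _ (lexx _) _ _ t (hi h)) H.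
apply: (le_trans (H _ _ _ _ _ _)); [lra|lra|by apply: ac_sub acw; lra| |lra|lra|].
  by apply: (ae_imply aew) => u {}H tu; apply: H; [lra|right; lra].
rewrite -mulrA ler_wpM2l //; first lra.
by apply: w_mid; lra.
Qed.

(** Interval induction on the property: if z and y agree at u then they agree on
    [u, v]. Near a time where they agree, z is within r of x and the Gronwall
    inequality applies; near a time where they differ, continuity makes the
    property hold vacuously. *)
Lemma perturbed_unique h y z : `|h| < d ->
  state_solution T x0 gs (shifted h) y ->
  (forall t, 0 <= t <= T -> `|y t - x t| <= r / 2) ->
  state_solution T x0 fs (shifted h) z ->
  forall t, 0 <= t <= T -> z t = y t.
Proof.
move=> hd soly yx solz; have [acy aey y0] := soly; have [acz aez z0] := solz.
have sT' := switching_shift l gap hd.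
have acw := acB acz acy.
have [G G1 HG] := gronwall V time_pos M0.
pose P u v := z u = y u -> forall t, u <= t <= v -> z t = y t.
suff : P 0 T by apply; rewrite z0 y0.
apply: interval_induction; first exact: time_pos.
  move=> u w v _ uw wv _ H1 H2 zy t tuv.
  have [tw|/ltW wt] := leP t w; first by apply: H1 => //; lra.
  by apply: H2; [apply: H1 => //; lra|lra].
have r20 : 0 < r / 2 by rewrite divr_gt0.
move=> t tT; have [zyt|zyt] := eqVneq (z t) (y t); last first.
  have e0 : 0 < `|z t - y t| by rewrite normr_gt0 subr_eq0.
  have [c c0 Hc] := ac_uniform acw e0.
  exists c => // u v u0 ut tv vT uvc zyu.
  have := Hc u t; rewrite zyu subrr subr0 ltxx => H.
  have tu : `|t - u| < c by rewrite ltr_norml; lra.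
  by have := H ltac:(lra) ltac:(lra) tu.
have {}zyt : z t - y t = 0 by rewrite zyt subrr.
have [c c0 Hc] := ac_uniform acw r20.
exists c => // u v u0 ut tv vT uvc zyu q quv.
have zx a : u <= a <= v -> `|z a - x a| <= r.
  move=> auv; have := Hc t a; rewrite zyt subr0 => H.
  have {}H : `|z a - y a| < r / 2 by apply: H; rewrite ?ltr_norml; lra.
  have := yx a ltac:(lra); have := ler_distD (y a) (z a) (x a); lra.
apply/eqP; rewrite -subr_eq0 -normr_le0.
have -> : 0 = G * `|z u - y u| by rewrite zyu subrr normr0 mulr0.
apply: (HG u v (fun t => z t - y t)); [lra|lra|lra| | |lra|lra].
  by apply: ac_sub acw; lra.
have swE : {ae mu, forall t : R, 0 < t < T -> u < t < v -> exists j : 'I_k.+1,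
     switched T fs (shifted h) (z t) t = gs j (z t) t /\
     switched T gs (shifted h) (y t) t = gs j (y t) t}.
  apply: (ae_piece hd) => j a aj aT ad auv; exists j.
  rewrite !(switchedE sT' _ _ aj); split=> //.
  by rewrite (ext_eq (ext j)) // zx //; lra.
have aezy := ae_imply2 aez aey (fun t => @conj _ _).
apply: (ae_imply2 aezy swE) => a [Hz Hy] H auv.
have aT : 0 < a < T by lra.
have [j [Ez Ey]] := H aT auv.
exists (gs j (z a) a - gs j (y a) a).
  by apply: is_deriveB; [rewrite -Ez; exact: Hz | rewrite -Ey; exact: Hy].
exact: (ext_lipschitz (ext j)).
Qed.

Local Notation sigma := (knot T s l.+1).
Variable p : R -> V.
Hypothesis solp : costate_solution T fs C s x p.

Let speed (j : 'I_k.+1) : V := gs j (x sigma) sigma.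

Lemma sigma_itv : 0 <= sigma <= T.
Proof. exact: (knot_itv sT (leqW (ltn_ord l))). Qed.

Lemma shift_itv h : `|h| < d -> [/\ 0 <= lo h, hi h <= T, hi h - lo h = `|h| &
  forall t, lo h <= t <= hi h -> `|t - sigma| <= `|h|].
Proof.
move=> hd; have [b1 b2 b3 b4] := shift_bounds l gap hd.
have k1 := knot_itv sT (leqW (ltnW (ltn_ord l))).
have k2 := knot_itv sT (ltn_ord l : (l.+2 <= k.+1)%N).
split=> //; [lra|lra|move=> t]; move: b2 b4; rewrite /shift_lo /shift_hi => b2 b4 tlh.
case: (leP sigma (sigma + h)) tlh b4 => hh tlh b4; rewrite ler_norml; lra.
Qed.

Lemma speed_continuous (j : 'I_k.+1) e : 0 < e -> exists2 c, 0 < c & forall t,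
  0 <= t <= T -> `|t - sigma| < c -> `|gs j (x t) t - speed j| < e.
Proof.
move=> e0; have [acx _ _] := solx.
have cx : continuous (fun t => x (clamp 0 T t)) := xc_continuous time_pos acx.
have cg := @ext_continuous _ _ _ _ _ _ _ _ _ (ext j) _ cx sigma.
have /continuous_epsP/(_ _ e0)[c c0 Hc] := cg.
exists c => // t tT tc; have := Hc t tc.
by rewrite !clamp_id // sigma_itv.
Qed.

(** Between the two switching times, y - x is O(|h|), so that q' is
    p (g_new(y, t) - g_old(x, t)) + O(|h|), and both fields are continuous along
    x at the switching time. *)
Lemma inside_rate e : 0 < e -> exists2 c, 0 < c & forall h y,
  `|h| < c -> `|h| < d -> state_solution T x0 gs (shifted h) y ->
  {ae mu, forall t : R, lo h < t < hi h ->
    exists2 dq, is_derive t (1 : R) (fun t => pairing (p t) (y t - x t)) (dq : R) &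
     `|dq - pairing (p sigma) (speed (new_piece h) - speed (old_piece h))| <= e}.
Proof.
move=> e0.
have [K K0 HK] := perturbed_close.
have [P [P0 HP Lp]] := costate_lipschitz solp.
(* c1 collects the coefficients of |h|; eta bounds the variation of the two
   fields along x near the switching time. *)
pose c1 := n%:R * (n%:R * M * P * K + n%:R * M * P * (M + M) + P * (M * K)).
have c10 : 0 <= c1 by rewrite !(mulr_ge0, addr_ge0).
have n0 : 0 <= n%:R :> R by [].
pose eta := e / (4 * (n%:R * P + 1)).
have nP1 : 0 < n%:R * P + 1 by rewrite ltr_wpDl // mulr_ge0.
have eta0 : 0 < eta by rewrite divr_gt0 // mulr_gt0.
have [c2 c20 Hw] := speed_continuous (widen_ord (leqnSn k) l) eta0.
have [c3 c30 Hl] := speed_continuous (lift ord0 l) eta0.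
exists (Num.min (Num.min c2 c3) (e / (2 * (c1 + 1)))).
  by rewrite !lt_min c20 c30 divr_gt0 // mulr_gt0 // ltr_wpDl.
move=> h y; rewrite !lt_min => /andP[/andP[hc2 hc3] hc1] hd soly.
have {}hc1 : c1 * `|h| <= e / 2.
  apply: (@le_trans _ _ ((c1 + 1) * (e / (2 * (c1 + 1))))).
    by apply: ler_pM => //; [lra|exact: ltW].
  have -> // : (c1 + 1) * (e / (2 * (c1 + 1))) = e / 2.
  by field; rewrite gt_eqF // ltr_wpDl.
have [lo0 hiT lohi tsig] := shift_itv hd.
have [_ close] := HK _ _ hd soly.
have speedP t j : j = new_piece h \/ j = old_piece h -> lo h < t < hi h ->
    `|gs j (x t) t - speed j| <= eta.
  move=> jP tlh; have tT : 0 <= t <= T by lra.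
  have th : `|t - sigma| <= `|h| by apply: tsig; lra.
  have [->|->] : j = widen_ord (leqnSn k) l \/ j = lift ord0 l.
    by case: jP => ->; rewrite /new_piece /old_piece; case: ifP; auto.
    by apply/ltW/Hw => //; apply: le_lt_trans hc2.
  by apply/ltW/Hl => //; apply: le_lt_trans hc3.
have aepy := ae_imply2 (costate_ae solp) (ae_inside hd soly) (fun t => @conj _ _).
apply: (ae_imply aepy) => t [Hp Hyx] tlh.
have tT : 0 < t < T by lra.
have tT' : 0 <= t <= T by lra.
have [jp [_ Dp]] := Hp tT; have [Dy Dx] := Hyx tlh.
set A := new_piece h in Dy *; set B := old_piece h in Dx *.
have Dq := is_derive_pairing Dp (is_deriveB Dy Dx).
eexists; first exact: Dq.
set w := y t - x t; set D := gs A (y t) t - gs B (x t) t.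
have wK : `|w| <= K * `|h| by exact: close.
have pP : `|p t| <= P by exact: HP.
have dpP : `|- (p t *m Bs jp t)| <= n%:R * M * P.
  rewrite normrN; apply: (le_trans (mulmx_norm_le _ _)).
  rewrite -mulrA ler_wpM2l // mulrC ler_pM //.
  exact: (ext_jac_bounded (ext jp)).
have pps : `|p t - p sigma| <= n%:R * M * P * `|h|.
  apply: (le_trans (Lp _ _ sigma_itv tT')).
  by rewrite ler_wpM2l ?mulr_ge0 // tsig //; lra.
have DD : `|D - (speed A - speed B)| <= M * (K * `|h|) + (eta + eta).
  have -> : D - (speed A - speed B) = (gs A (y t) t - gs A (x t) t) +
      ((gs A (x t) t - speed A) - (gs B (x t) t - speed B)).
    by rewrite /D opprD addrACA -opprD [RHS]addrA [in RHS]addrA subrK.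
  apply: (le_trans (ler_normD _ _)); rewrite lerD //.
    apply: (le_trans (ext_lipschitz (ext A) _ _ _)).
    by rewrite ler_wpM2l.
  by apply: (le_trans (ler_normB _ _)); rewrite lerD // speedP; auto.
have S0 : `|speed A - speed B| <= M + M.
  by apply: (le_trans (ler_normB _ _)); rewrite lerD // (ext_bounded (ext _)).
have -> : pairing (- (p t *m Bs jp t)) w + pairing (p t) D -
    pairing (p sigma) (speed A - speed B)
   = pairing (- (p t *m Bs jp t)) w + pairing (p t) (D - (speed A - speed B))
     + pairing (p t - p sigma) (speed A - speed B).
  by rewrite [pairing _ (D - _)]pairingBr [pairing (p t - _) _]pairingBl; ring.
have b1 : `|pairing (- (p t *m Bs jp t)) w| <= n%:R * (n%:R * M * P * (K * `|h|)).
  by apply: (le_trans (pairing_norm _ _)); rewrite ler_wpM2l // ler_pM.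
have b2 : `|pairing (p t) (D - (speed A - speed B))| <=
    n%:R * (P * (M * (K * `|h|) + (eta + eta))).
  by apply: (le_trans (pairing_norm _ _)); rewrite ler_wpM2l // ler_pM.
have b3 : `|pairing (p t - p sigma) (speed A - speed B)| <=
    n%:R * (n%:R * M * P * `|h| * (M + M)).
  by apply: (le_trans (pairing_norm _ _)); rewrite ler_wpM2l // ler_pM.
apply: (le_trans (ler_normD _ _)); apply: (le_trans (lerD (ler_normD _ _) (lexx _))).
apply: (le_trans (lerD (lerD b1 b2) b3)).
have -> : n%:R * (n%:R * M * P * (K * `|h|)) + n%:R * (P * (M * (K * `|h|) + (eta + eta)))
    + n%:R * (n%:R * M * P * `|h| * (M + M)) = c1 * `|h| + 2 * (n%:R * P * eta).
  by rewrite /c1; ring.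
have b4 : n%:R * P * eta <= e / 4.
  apply: (@le_trans _ _ ((n%:R * P + 1) * eta)); first by rewrite ler_wpM2r ?lerDl // ltW.
  have -> // : (n%:R * P + 1) * eta = e / 4.
  by rewrite /eta; field; rewrite gt_eqF.
lra.
Qed.

(** With p' = - p B and (y - x)' = (y - x) B^T + O(|y - x|^2), the linear terms
    of the derivative of the pairing cancel. *)
Lemma outside_rate : exists2 K, 0 <= K & forall h y,
  `|h| < d -> K * `|h| <= r -> state_solution T x0 gs (shifted h) y ->
  {ae mu, forall t : R, hi h < t < T ->
    exists2 dq, is_derive t (1 : R) (fun t => pairing (p t) (y t - x t)) (dq : R) &
     `|dq| <= K * `|h| ^+ 2}.
Proof.
have [K K0 HK] := perturbed_close.
have [P [P0 HP Lp]] := costate_lipschitz solp.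
have n0 : 0 <= n%:R :> R by [].
pose K' := n%:R * (P * (M * K ^+ 2)).
have K'0 : 0 <= K' by rewrite !mulr_ge0 ?exprn_ge0.
exists (K + K'); first by rewrite addr_ge0.
move=> h y hd hr soly; have [_ close] := HK _ _ hd soly.
have [lo0 hiT lohi _] := shift_itv hd.
have hr' : K * `|h| <= r by apply: le_trans hr; rewrite ler_wpM2r // lerDl.
have aepy := ae_imply2 (costate_ae solp) (ae_outside hd soly) (fun t => @conj _ _).
apply: (ae_imply aepy) => t [Hp Hyx] tlh.
have tT : 0 < t < T by have := normr_ge0 h; lra.
have tT' : 0 <= t <= T by lra.
have [jp [jpt Dp]] := Hp tT; have [j [jt It Dy Dx]] := Hyx tT (or_intror (andP tlh).1).
have ej : jp = j by exact: (piece_unique sT jpt jt).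
rewrite {jp jpt Hp}ej in Dp.
have Dq := is_derive_pairing Dp (is_deriveB Dy Dx).
eexists; first exact: Dq.
have yr : `|y t - x t| <= r by apply: (le_trans (close _ tT')).
set w := y t - x t.
have -> : pairing (- (p t *m Bs j t)) w + pairing (p t) (gs j (y t) t - gs j (x t) t) =
    pairing (p t) (gs j (y t) t - gs j (x t) t - w *m (Bs j t)^T).
  rewrite [RHS]pairingBr -pairing_adjoint addrC; congr (_ + _).
  by rewrite /pairing mulNmx mxE.
apply: (le_trans (pairing_norm _ _)).
apply: (@le_trans _ _ (n%:R * (P * (M * (K * `|h|) ^+ 2)))).
  rewrite ler_wpM2l // ler_pM // ?HP //.
  apply: (le_trans (ext_taylor (ext j) It yr)).
  by rewrite ler_wpM2l // lerXn2r // ?nnegrE ?mulr_ge0 //; exact: close.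
have -> : n%:R * (P * (M * (K * `|h|) ^+ 2)) = K' * `|h| ^+ 2 by rewrite /K'; ring.
by rewrite ler_wpM2r ?exprn_ge0 // lerDr.
Qed.

(** The pairing vanishes at the start of the perturbed interval, which has length
    |h|, and changes by O(h^2) after its end. *)
Lemma pairing_expansion e : 0 < e -> exists2 c, 0 < c & forall h y,
  `|h| < c -> state_solution T x0 gs (shifted h) y ->
  `|pairing (p T) (y T - x T) -
    h * pairing (p sigma) (speed (widen_ord (leqnSn k) l) - speed (lift ord0 l))|
  <= e * `|h|.
Proof.
move=> e0; have e20 : 0 < e / 2 by lra.
have [K K0 HK] := perturbed_close.
have [P [P0 HP Lp]] := costate_lipschitz solp.
have [c1 c10 Hin] := inside_rate e20.
have [K' K'0 Hout] := outside_rate.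
pose c2 := r / (K' + 1); pose c3 := e / (2 * (K' * T + 1)).
have KT0 : 0 <= K' * T by rewrite mulr_ge0 // time_pos.
have c20 : 0 < c2 by rewrite divr_gt0 // ltr_wpDl.
have c30 : 0 < c3 by rewrite divr_gt0 // mulr_gt0 // ltr_wpDl.
exists (Num.min (Num.min c1 d) (Num.min c2 c3)).
  by rewrite !lt_min c10 d0 c20 c30.
move=> h y; rewrite !lt_min => /andP[/andP[hc1 hd] /andP[hc2 hc3]] soly.
have [at_lo close] := HK _ _ hd soly.
have [lo0 hiT lohi tsig] := shift_itv hd.
have hr : K' * `|h| <= r.
  apply: (@le_trans _ _ ((K' + 1) * c2)); first by apply: ler_pM => //; [lra|exact: ltW].
  by rewrite /c2 mulrC divfK // gt_eqF // ltr_wpDl.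
pose q t := pairing (p t) (y t - x t).
pose jump := pairing (p sigma) (speed (new_piece h) - speed (old_piece h)).
have Lw : lipschitz_on_itv 0 T (M + M) (fun t => y t - x t).
  move=> u v uT vT; rewrite opprD addrACA -opprD mulrDl.
  apply: (le_trans (ler_normB _ _)); rewrite lerD //.
    exact: (ext_solution_lipschitz hd soly).
  exact: ext_x_lipschitz.
have acq : abs_continuous 0 T q.
  apply: lipschitz_ac; apply: (pairing_lipschitz _ _ Lp Lw HP close).
    by rewrite !mulr_ge0.
  by rewrite addr_ge0.
have lohi' : lo h <= hi h by rewrite -subr_ge0 lohi.
have q_lo : q (lo h) = 0.
  rewrite /q at_lo; last by rewrite lo0 lexx.
  by rewrite subrr -(subrr (p T)) pairingBr subrr.
have q_hi : `|q (hi h) - `|h| * jump| <= e / 2 * `|h|.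
  (* The derivative of q1 is at most e / 2 in norm. *)
  pose q1 t := q t - t * jump.
  have ac1 : abs_continuous (lo h) (hi h) q1.
    apply: acB; first by apply: ac_sub acq; lra.
    apply: (@lipschitz_ac _ _ _ _ `|jump|) => u v _ _.
    by rewrite -mulrBl normrM mulrC.
  have H : `|q1 (hi h) - q1 (lo h)| <= e / 2 * `|hi h - lo h|.
    apply: (@ac_lipschitz R R (lo h) (hi h) q1 (e / 2)) => //.
    - exact: ltW.
    - apply: (ae_imply (Hin _ _ hc1 hd soly)) => t Ht tlh.
      have [dq Dq bq] := Ht tlh; exists (dq - jump); last exact: bq.
      apply: is_deriveB; apply/is_derive1P => e' e'0; exists 1 => // b _.
      have -> : (t + b) * jump - t * jump - b *: jump = 0.
        by rewrite /GRing.scale /=; ring.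
      by rewrite normr0 mulr_ge0 // ltW.
    - by rewrite lexx.
    - by rewrite lexx andbT.
  move: H; rewrite /q1 q_lo lohi [`|(`|h|)|]normr_id.
  have -> // : q (hi h) - hi h * jump - (0 - lo h * jump) = q (hi h) - `|h| * jump.
  by rewrite -lohi; ring.
have q_T : `|q T - q (hi h)| <= e / 2 * `|h|.
  apply: (@le_trans _ _ (K' * `|h| ^+ 2 * `|T - hi h|)).
    apply: (@ac_lipschitz R R (hi h) T q) => //.
    - by rewrite mulr_ge0 ?exprn_ge0.
    - by apply: ac_sub acq; lra.
    - exact: Hout.
    - by rewrite lexx.
    - by rewrite lexx andbT.
  rewrite [`|T - _|]ger0_norm ?subr_ge0 //.
  have h0 := normr_ge0 h.
  apply: (@le_trans _ _ (K' * `|h| ^+ 2 * T)).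
    by rewrite ler_wpM2l ?mulr_ge0 ?exprn_ge0 //; lra.
  have -> : K' * `|h| ^+ 2 * T = K' * T * `|h| * `|h| by ring.
  rewrite ler_wpM2r //.
  apply: (@le_trans _ _ ((K' * T + 1) * c3)); first by apply: ler_pM => //; [lra|exact: ltW].
  have -> // : (K' * T + 1) * c3 = e / 2.
  by rewrite /c3; field; rewrite gt_eqF // ltr_wpDl.
have -> : h * pairing (p sigma) (speed (widen_ord (leqnSn k) l) - speed (lift ord0 l)) =
    `|h| * jump.
  rewrite /jump /new_piece /old_piece.
  case: (ltP 0 h) => h0; first by rewrite gtr0_norm.
  by rewrite ler0_norm // !pairingBr; ring.
rewrite -/(q T); have := ler_distD (q (hi h)) (q T) (`|h| * jump); lra.
Qed.

End Perturbation.

(** * The derivative of the objective *)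

Lemma row_grad_expansion (R : realType) (n : nat) (C : 'rV[R]_n -> R) (z : 'rV[R]_n) :
  differentiable C z -> forall e, 0 < e -> exists2 d, 0 < d &
    forall z', `|z' - z| < d ->
      `|C z' - C z - pairing (row_grad C z) (z' - z)| <= e * `|z' - z|.
Proof.
move=> dC e e0; have dE w : 'd C z w = pairing (row_grad C z) w.
  rewrite pairingE {1}(row_sum_delta w) linear_sum; apply: eq_bigr => i _.
  by rewrite linearZ /= -deriveE // mxE mulrC.
have /eqaddoP/(_ e e0) := diff_locally dC.
move=> /nbhs_normP[d /= d0 Hd]; exists d => // z' zd.
have := Hd (z' - z); rewrite /ball_ /= sub0r normrN => /(_ zd).
by rewrite !fctE /= subrK -dE opprD addrA.
Qed.

Theorem theorem2p4 (R : realType) (n m k : nat) (N : 'rV[R]_n -> R)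
    (T : R) (x0 : 'rV[R]_n)
    (f : 'rV[R]_n * 'rV[R]_m -> 'rV[R]_n)
    (phi : 'I_k.+1 -> 'rV[R]_n -> R -> 'rV[R]_m)
    (C : 'rV[R]_n -> R) (s : 'rV[R]_k) (x : R -> 'rV[R]_n) :
  let fs := closed_loop f phi in
  is_norm N ->
  0 < T ->
  (forall z, differentiable f z) ->
  (forall z, differentiable C z) ->
  switching_points T s ->
  state_solution T x0 fs s x ->
  state_regularity N T fs s x ->
  lipschitz_C1_near C (x T) ->
  unique_on 0 T (costate_solution T fs C s x) /\
  forall p : R -> 'rV[R]_n, costate_solution T fs C s x p ->
  forall j : 'I_k,
    (\forall h \near (0 : R),
       unique_on 0 T (state_solution T x0 fs (s + h *: delta_mx 0 j))) /\
    is_derive s (delta_mx 0 j) (objective T x0 fs C)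
      (hamiltonian fs (widen_ord (leqnSn k) j) (x (s 0 j)) (p (s 0 j)) (s 0 j)
       - hamiltonian fs (lift ord0 j) (x (s 0 j)) (p (s 0 j)) (s 0 j)).
Proof.
move=> fs normN T0 _ dC sT solx regx _; have [acx _ _] := solx.
have [r [d1 [M [gs [Bs [r0 d10 M0 ext1]]]]]] :=
  state_regularity_extension normN sT acx regx.
have [d2 d20 gap2] := gap_lower_bound sT.
pose d := Num.min d1 d2.
have d0 : 0 < d by rewrite lt_min d10.
have gap i : (i <= k)%N -> knot T s i + d < knot T s i.+1.
  move=> ik; apply: le_lt_trans (gap2 i ik).
  by rewrite lerD2l ge_min lexx orbT.
have dd1 : d <= d1 by rewrite ge_min lexx.
have ext j : extends_near (fs j) x
    (fun t => 0 <= t <= T /\ knot T s j - d <= t <= knot T s j.+1 + d) r M (gs j) (Bs j).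
  by apply: extends_near_weaken (ext1 j) => // t [tT tj]; split=> //; lra.
split.
  have [p solp] := costate_exists C sT d0 M0 ext.
  exists p => // q solq t tT.
  exact: (costate_unique sT d0 M0 ext solp solq).
move=> p solp j.
have [K K0 HK] := perturbed_close sT r0 d0 M0 gap ext solx j.
pose c0 := Num.min d (r / (2 * (K + 1))).
have K1 : 0 < K + 1 by lra.
have c00 : 0 < c0 by rewrite lt_min d0 divr_gt0 // mulr_gt0.
(* Below c0 the perturbed trajectory stays within r / 2 of x. *)
have good h : `|h| < c0 -> exists y : R -> 'rV[R]_n,
    [/\ state_solution T x0 gs (s + h *: delta_mx 0 j) y,
        state_solution T x0 fs (s + h *: delta_mx 0 j) y,
        forall z, state_solution T x0 fs (s + h *: delta_mx 0 j) z ->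
          forall t, 0 <= t <= T -> z t = y t
      & `|y T - x T| <= K * `|h|].
  rewrite lt_min => /andP[hd hr].
  have [y soly] := ext_solution_exists x0 M0 gap ext j hd.
  have [_ close] := HK _ _ hd soly.
  have close2 t : 0 <= t <= T -> `|y t - x t| <= r / 2.
    move=> tT; apply: (le_trans (close t tT)).
    apply: (@le_trans _ _ ((K + 1) * (r / (2 * (K + 1))))).
      by apply: ler_pM => //; [lra|exact: ltW].
    have -> // : (K + 1) * (r / (2 * (K + 1))) = r / 2.
    by field; rewrite gt_eqF.
  exists y; split=> //.
  - apply/(state_solution_ext x0 gap ext j hd) => // t tT.
    by apply: (le_trans (close2 t tT)); lra.
  - move=> z solz.
    exact: (perturbed_unique sT r0 M0 gap ext hd soly close2 solz).
  - by apply: close; rewrite ltW //= lexx.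
split.
  near=> h.
  have [|y [_ soly uniq _]] := good h; first by near: h; exact: (@nbhs0_lt R R).
  by exists y.
have TT : 0 <= T <= T by rewrite ltW //= lexx.
have objE h y : `|h| < c0 -> state_solution T x0 fs (s + h *: delta_mx 0 j) y ->
    objective T x0 fs C (s + h *: delta_mx 0 j) = C (y T).
  move=> hc soly; have [y' [_ soly' uniq _]] := good h hc.
  rewrite /objective (uniq y soly T TT) (uniq _ (getPex _) T TT) //.
  by exists y.
have obj0 : objective T x0 fs C s = C (x T).
  have := objE 0 x; rewrite scale0r addr0 normr0; exact.
pose speed i := gs i (x (knot T s j.+1)) (knot T s j.+1).
(* The switching time lies in the closures of both adjacent pieces, where f_i and
   its extension coincide along x. *)
have hamE (i : 'I_k.+1) : knot T s i <= knot T s j.+1 <= knot T s i.+1 ->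
    hamiltonian fs i (x (s 0 j)) (p (s 0 j)) (s 0 j) =
    pairing (p (knot T s j.+1)) (speed i).
  move=> ji; rewrite -(knotS T) /hamiltonian /pairing /speed.
  rewrite (ext_eq (ext i)) //.
    by split; [apply: knot_itv => //; exact: leqW | lra].
  by rewrite subrr normr0 ltW.
have lastj : knot T s j <= knot T s j.+1 by apply/ltW/sT/ltnW/ltn_ord.
have nextj : knot T s j.+1 <= knot T s j.+2 by apply/ltW/sT/ltn_ord.
rewrite (hamE (widen_ord (leqnSn k) j)); last by rewrite lexx andbT.
rewrite (hamE (lift ord0 j)); last by apply/andP; split; [exact: lexx | exact: nextj].
rewrite -pairingBr.
apply/is_deriveP => e e0; have e20 : 0 < e / 2 by lra.
have [c1 c10 Hq] := pairing_expansion sT r0 d0 M0 gap ext solx j solp e20.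
have eK0 : 0 < e / (2 * (K + 1)) by rewrite divr_gt0 // mulr_gt0.
have [c2 c20 HC] := row_grad_expansion (dC (x T)) eK0.
exists (Num.min c0 (Num.min c1 (c2 / (K + 1)))).
  by rewrite lt_min c00 lt_min c10 divr_gt0.
move=> h; rewrite lt_min => /andP[hc0]; rewrite lt_min => /andP[hc1 hc2].
have [y [soly soly' _ close]] := good h hc0.
rewrite (objE h y) // obj0.
have h0 := normr_ge0 h.
have yc2 : `|y T - x T| < c2.
  move: hc2; rewrite ltr_pdivlMr // => hc2; apply: le_lt_trans hc2.
  by apply: (le_trans close); rewrite mulrC ler_wpM2l //; lra.
have H1 := HC _ yc2; have H2 := Hq _ _ hc1 soly.
have [_ _ pT] := solp; rewrite -pT in H1.
have H3 : e / (2 * (K + 1)) * `|y T - x T| <= e / 2 * `|h|.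
  apply: (@le_trans _ _ (e / (2 * (K + 1)) * ((K + 1) * `|h|))).
    apply: ler_wpM2l; first exact: ltW.
    by apply: (le_trans close); apply: ler_wpM2r => //; lra.
  have -> // : e / (2 * (K + 1)) * ((K + 1) * `|h|) = e / 2 * `|h|.
  by field; rewrite gt_eqF.
have := ler_distD (pairing (p T) (y T - x T)) (C (y T) - C (x T))
  (h * pairing (p (knot T s j.+1)) (speed (widen_ord (leqnSn k) j) - speed (lift ord0 j))).
rewrite /GRing.scale /=; lra.
Unshelve. all: by end_near. Qed.
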